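(* For any $k\ge2$ there exist $c,C>0$ such that $$c\,e^{-kz}\le\widehat\mu\big(\{\Lambda\in\widehat X_k:\Delta(\Lambda)\ge z\}\big)\le C\,e^{-kz}\quad\text{for all }z\ge0.$$
   Context: $\widehat{X}_k$ is the space of unimodular grids in $\mathbb{R}^k$ (sets $g\mathbb{Z}^k+\mathbf w$, $g\in\mathrm{SL}_k(\mathbb{R})$, $\mathbf w\in\mathbb{R}^k$), identified with $\mathrm{ASL}_k(\mathbb{R})/\mathrm{ASL}_k(\mathbb{Z})$, and $\widehat\mu$ is its invariant probability measure. $\Delta(\Lambda)=\log\inf_{\mathbf v\in\Lambda}\|\mathbf v\|$, with $\|\cdot\|$ the supremum norm on $\mathbb{R}^k$; thus $\Delta(\Lambda)\ge z$ iff $\Lambda$ does not meet the open sup-norm ball of radius $e^z$ centered at $0$. *)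

(* Defs.v *)
From HB Require Import structures.
From mathcomp Require Import all_boot all_order all_algebra.
From mathcomp Require Import all_classical all_reals all_analysis.
Set Implicit Arguments.
Unset Strict Implicit.
Unset Printing Implicit Defensive.
Import Order.TTheory GRing.Theory Num.Theory.
Import numFieldNormedType.Exports.
Local Open Scope classical_set_scope.
Local Open Scope ring_scope.

Section Grids.
Context {R : realType} {k : nat}.

(* ASL_k(R), as pairs (g, w) standing for the map v |-> g v + w; it carries the
   topology induced from 'M[R]_k * 'cV[R]_k. *)
Definition ASL_set : set ('M[R]_k * 'cV[R]_k) := [set a | \det a.1 = 1].
Definition ASL : topologicalType := set_type ASL_set.

Definition affine (a : 'M[R]_k * 'cV[R]_k) (v : 'cV[R]_k) : 'cV[R]_k :=
  a.1 *m v + a.2.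

Definition Zlattice : set 'cV[R]_k :=
  range (fun m : 'cV[int]_k => map_mx intr m).

Definition unimodular_grids : set (set 'cV[R]_k) :=
  [set affine (val a) @` Zlattice | a in [set: ASL]].

Definition grid : Type := set_type unimodular_grids.
HB.instance Definition _ := Choice.on grid.

Definition grid_points (L : grid) : set 'cV[R]_k := val L.

Lemma grid_of_subproof (a : ASL) :
  affine (val a) @` Zlattice \in unimodular_grids.
Proof. by apply/mem_set; exists a. Qed.

Definition grid_of (a : ASL) : grid := SigSub (grid_of_subproof a).

Lemma ASL_id_subproof : (1%:M, 0) \in ASL_set.
Proof. by apply/mem_set; rewrite /ASL_set/= det1. Qed.

HB.instance Definition _ := isPointed.Build grid
  (grid_of (SigSub ASL_id_subproof)).

(* Two elements of ASL_k(R) have the same image under grid_of iff they lie in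
   the same left coset of ASL_k(Z), so the quotient topology along grid_of is
   that of ASL_k(R)/ASL_k(Z). *)
Definition grid_open (U : set grid) : Prop := open (grid_of @^-1` U).

Lemma grid_openT : grid_open setT.
Proof. by rewrite /grid_open preimage_setT; exact: openT. Qed.

Lemma grid_openI (A B : set grid) :
  grid_open A -> grid_open B -> grid_open (A `&` B).
Proof. exact: openI. Qed.

Lemma grid_open_bigU (I : Type) (f : I -> set grid) :
  (forall i, grid_open (f i)) -> grid_open (\bigcup_i f i).
Proof. by move=> fo; apply: bigcup_open => i _; exact: fo. Qed.

HB.instance Definition _ :=
  isOpenTopological.Build grid grid_openT grid_openI grid_open_bigU.

Definition borel_grid := g_sigma_algebraType (@open grid).

Lemma grid_act_subproof (a : ASL) (L : grid) :
  affine (val a) @` grid_points L \in unimodular_grids.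
Proof.
have /set_mem[b _ bL] := valP L; apply/mem_set.
have /set_mem a1 := valP a; have /set_mem b1 := valP b.
have abP : ((val a).1 *m (val b).1, affine (val a) (val b).2) \in ASL_set.
  by apply/mem_set; rewrite /ASL_set/= det_mulmx a1 b1 mulr1.
exists (SigSub abP) => //=.
rewrite /grid_points -bL image_comp; apply: eq_imagel => v _ /=.
by rewrite /affine/= mulmxDr mulmxA addrA.
Qed.

Definition grid_act (a : ASL) (L : grid) : grid :=
  SigSub (grid_act_subproof a L).

Definition ASL_invariant (mu : set borel_grid -> \bar R) : Prop :=
  forall (a : ASL) (A : set borel_grid), measurable A ->
    mu (grid_act a @^-1` A) = mu A.

(* Extended-real valued, with value -oo when 0 is in the grid: the real-valued
   ln satisfies ln 0 = 0, which would be wrong there. *)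
Definition Delta (L : grid) : \bar R :=
  lne (ereal_inf [set `|v|%:E | v in grid_points L]).

End Grids.

Arguments ASL : clear implicits.
Arguments grid : clear implicits.
Arguments borel_grid : clear implicits.

(* Main.v *)
(** A grid misses a large ball essentially when its dual lattice contains a short
    vector. If the dual lattice has a nonzero vector of norm at most of order
    [1 / r], the grid lies on widely spaced parallel hyperplanes, and one of a
    bounded number of translations moves all of them off the ball of radius [r].
    Conversely, a grid that misses the ball has a short dual vector, by a
    transference argument by induction on the rank.

    It remains to see that the dual lattice meets the ball of radius [t] with
    probability of order [t ^ k]. Only the invariance of the measure is used.
    Lower bound: for some [C] the dual lattice meets the ball of radius [C] with
    probability at least 1/2, and that ball is covered by about [(C / t) ^ k]
    images of the ball of radius [t] under determinant 1 maps. Upper bound: average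
    over a family of long thin shears. For a fixed lattice the proportion of shears
    producing a short vector is eventually at most of order [t ^ k], because a
    unimodular lattice has at most of order [T ^ k] points in a box of size [T] once
    [T] is large; a Fatou argument then bounds the probability. *)

Require Import Defs.
From HB Require Import structures.
From mathcomp Require Import all_boot all_order all_algebra.
From mathcomp Require Import all_classical all_reals all_analysis.
From mathcomp Require Import measurable_realfun ring lra.
Set Implicit Arguments.
Unset Strict Implicit.
Unset Printing Implicit Defensive.
Import Order.TTheory GRing.Theory Num.Theory.
Import numFieldNormedType.Exports.
Local Open Scope classical_set_scope.
Local Open Scope ring_scope.

(** * Transference *)

Section Dot.
Context {R : realType} {n : nat}.
Implicit Types (u v x y : 'cV[R]_n) (A : 'M[R]_n).

Definition dot u x : R := (u^T *m x) 0 0.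

Lemma dotE u x : dot u x = \sum_i u i 0 * x i 0.
Proof. by rewrite /dot mxE; apply: eq_bigr => i _; rewrite mxE. Qed.

Lemma dotC u x : dot u x = dot x u.
Proof. by rewrite !dotE; apply: eq_bigr => i _; rewrite mulrC. Qed.

Lemma dotDr u x y : dot u (x + y) = dot u x + dot u y.
Proof. by rewrite /dot mulmxDr mxE. Qed.

Lemma dotZr a u x : dot u (a *: x) = a * dot u x.
Proof. by rewrite /dot -scalemxAr mxE. Qed.

Lemma dotBr u x y : dot u (x - y) = dot u x - dot u y.
Proof. by rewrite dotDr -scaleN1r dotZr mulN1r. Qed.

Lemma dotDl u v x : dot (u + v) x = dot u x + dot v x.
Proof. by rewrite dotC dotDr !(dotC x). Qed.

Lemma dotZl a u x : dot (a *: u) x = a * dot u x.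
Proof. by rewrite dotC dotZr dotC. Qed.

Lemma dot0r u : dot u 0 = 0.
Proof. by rewrite /dot mulmx0 mxE. Qed.

Lemma dot_mulmx A u x : dot (A *m u) x = dot u (A^T *m x).
Proof. by rewrite /dot trmx_mul mulmxA. Qed.

Lemma dot_mulmx_delta A u i : dot u (A *m delta_mx i 0) = (A^T *m u) i 0.
Proof.
rewrite dotC dot_mulmx dotE (bigD1 i)//= big1 => [|l li].
  by rewrite addr0 [delta_mx _ _ _ _]mxE !eqxx mul1r.
by rewrite [delta_mx _ _ _ _]mxE (negbTE li) mul0r.
Qed.

Lemma sqr_coord_le_dot x i : x i 0 ^+ 2 <= dot x x.
Proof.
rewrite dotE (bigD1 i)//= expr2 lerDl sumr_ge0// => j _.
by rewrite -expr2 sqr_ge0.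
Qed.

Lemma dot_ge0 x : 0 <= dot x x.
Proof. by rewrite dotE sumr_ge0// => i _; rewrite -expr2 sqr_ge0. Qed.

Lemma dot_eq0 x : dot x x = 0 -> x = 0.
Proof.
move=> x0; apply/matrixP => i j; rewrite (ord1 j) mxE; apply/eqP.
by rewrite -sqrf_eq0 eq_le sqr_ge0 -x0 sqr_coord_le_dot.
Qed.

Lemma dot_gt0 x : x != 0 -> 0 < dot x x.
Proof.
move=> x0; rewrite lt_def dot_ge0 andbT.
by apply: contra_neq x0 => /dot_eq0.
Qed.

End Dot.

Lemma round_exists {R : realType} (c : R) : exists m : int, `|c - m%:~R| <= 2^-1.
Proof.
exists (Num.floor (c + 2^-1)).
have /andP[h1] := floor_itv (c + 2^-1); rewrite intrD => h2.
rewrite ler_norml; apply/andP; split; lra.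
Qed.

Section Transference.
Context {R : realType} {n : nat}.
Implicit Types (u v w x y : 'cV[R]_n) (L : set 'cV[R]_n).

Definition subgroup L := L 0 /\ forall x y, L x -> L y -> L (x - y).

(* The linear span, as a double annihilator. *)
Definition span_of L : set 'cV[R]_n :=
  [set x | forall a, (forall y, L y -> dot a y = 0) -> dot a x = 0].

Lemma subgroupZ L (m : int) x : subgroup L -> L x -> L (m%:~R *: x).
Proof.
move=> [L0 LB] Lx.
have LN y : L y -> L (- y) by move=> Ly; rewrite -sub0r; exact: LB.
have LM (p : nat) : L (p%:R *: x).
  elim: p => [|p IH]; first by rewrite scale0r.
  rewrite -[p.+1]addn1 natrD scalerDl scale1r -[X in _ + X]opprK.
  by apply: LB => //; exact: LN.
case: m => p; first exact: LM.
by rewrite NegzE mulrNz scaleNr; apply: LN; exact: LM.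
Qed.

Lemma near_shortest L (e : R) : 0 < e ->
  (forall x, L x -> x != 0 -> e <= dot x x) -> (exists2 x, L x & x != 0) ->
  exists v, [/\ L v, v != 0 &
    forall x, L x -> x != 0 -> dot v v <= 2 * dot x x].
Proof.
move=> e0 gap [x0 Lx0 x00].
pose S := [set dot x x | x in [set x | L x /\ x != 0]].
have Slb : lbound S e by move=> _ [x [Lx x0'] <-]; exact: gap.
have Sinf : has_inf S by split; [exists (dot x0 x0), x0|exists e].
have infe : e <= inf S by apply: lb_le_inf => //; case: Sinf.
have /(inf_adherent (lt_le_trans e0 infe)) := Sinf.
move=> [_ [v [Lv v0] <-] vlt]; exists v; split=> // x Lx xn0.
have : inf S <= dot x x by apply: ge_inf; [exists e|exists x].
lra.
Qed.

(** The orthogonal projection onto the hyperplane perpendicular to [v], as a symmetric matrix. *)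
Definition proj v : 'M[R]_n := 1%:M - (dot v v)^-1 *: (v *m v^T).

Lemma projE v x : proj v *m x = x - (dot v x / dot v v) *: v.
Proof.
rewrite /proj mulmxBl mul1mx -scalemxAl -mulmxA [v^T *m x]mx11_scalar.
by rewrite mul_mx_scalar scalerA mulrC.
Qed.

Lemma proj_sym v : (proj v)^T = proj v.
Proof. by rewrite /proj linearB/= trmx1 linearZ/= trmx_mul trmxK. Qed.

Lemma dot_proj v x y : dot (proj v *m x) y = dot x (proj v *m y).
Proof. by rewrite dot_mulmx proj_sym. Qed.

Lemma proj_self v : v != 0 -> proj v *m v = 0.
Proof. by move=> v0; rewrite projE divff ?scale1r ?subrr// gt_eqF ?dot_gt0. Qed.

Lemma dot_proj_line v x (t : R) : v != 0 ->
  dot (proj v *m x + t *: v) (proj v *m x + t *: v) =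
  dot (proj v *m x) (proj v *m x) + t ^+ 2 * dot v v.
Proof.
move=> v0; have h : dot (proj v *m x) v = 0.
  by rewrite dot_proj proj_self// dot0r.
rewrite !dotDr !dotDl !dotZr !dotZl (dotC v) h; ring.
Qed.

Lemma dot_proj_le v x : v != 0 -> dot (proj v *m x) (proj v *m x) <= dot x x.
Proof.
move=> v0; have -> : dot x x = dot (proj v *m x + (dot v x / dot v v) *: v)
    (proj v *m x + (dot v x / dot v v) *: v) by rewrite projE subrK.
by rewrite dot_proj_line// lerDl mulr_ge0 ?sqr_ge0 ?dot_ge0.
Qed.

(** Subtracting multiples of [v] changes only the component along [v]; rounding its coefficient
    leaves at most 1/2, whose square gives the factor 1/4. *)
Lemma proj_reduce v w : v != 0 ->
  exists m : int, dot (w - m%:~R *: v) (w - m%:~R *: v) <=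
    dot (proj v *m w) (proj v *m w) + dot v v / 4.
Proof.
move=> v0; have [m hm] := round_exists (dot v w / dot v v); exists m.
have -> : w - m%:~R *: v = proj v *m w + (dot v w / dot v v - m%:~R) *: v.
  by rewrite projE scalerBl addrA subrK.
rewrite dot_proj_line// lerD2l mulrC ler_wpM2l ?dot_ge0//.
move: hm; move: (dot v w / dot v v - m%:~R) => t.
rewrite ler_norml => /andP[h1 h2].
have : 0 <= (2^-1 - t) * (2^-1 + t) by rewrite mulr_ge0; lra.
lra.
Qed.

(* Induction on the rank, replacing [L] by its projection orthogonally to an
   almost shortest vector [v]: the projected subgroup still has a gap of order
   [dot v v], so if it covers its span at scale [rho] then [dot v v] is at most
   of order [rho] and [L] covers its span as well. *)
Lemma transference (d : nat) L (U : {vspace 'cV[R]_n}) (e rho : R) :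
  0 < e -> 0 < rho -> subgroup L ->
  (forall x, L x -> x != 0 -> e <= dot x x) ->
  (forall x, L x -> x \in U) -> (\dim U <= d)%N ->
  (exists u, [/\ forall x, L x -> dot u x \is a Num.int,
     exists2 x, L x & dot u x != 0 & dot u u * rho <= 5 ^+ d]) \/
  (forall x, span_of L x -> exists2 y, L y & dot (x - y) (x - y) <= rho).
Proof.
elim: d L U e rho => [|d IH] L U e rho e0 rho0 sL gap LU dU.
  right=> x spx; exists 0; first by case: sL.
  suff -> : x = 0 by rewrite subr0 dot0r ltW.
  apply: dot_eq0; apply: spx => y /LU.
  move: dU; rewrite leqn0 dimv_eq0 => /eqP ->.
  by rewrite memv0 => /eqP ->; rewrite dot0r.
have [|/forallNP L0] := pselect (exists x, L x /\ x != 0); last first.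
  right=> x spx; exists 0; first by case: sL.
  suff -> : x = 0 by rewrite subr0 dot0r ltW.
  apply: dot_eq0; apply: spx => y Ly; have [->|y0] := eqVneq y 0.
    by rewrite dot0r.
  by case: (L0 y).
move=> [x0 [Lx0 x00]].
have [v [Lv v0 vmin]] := near_shortest e0 gap (ex_intro2 _ _ x0 Lx0 x00).
have q0 := dot_gt0 v0; set q := dot v v in q0 vmin.
pose piL := [set proj v *m x | x in L].
have LZ m x : L x -> L (x - m%:~R *: v).
  by move=> Lx; apply: sL.2 => //; exact: subgroupZ.
have projZ m x : proj v *m (x - m%:~R *: v) = proj v *m x.
  by rewrite mulmxBr -scalemxAr proj_self// scaler0 subr0.
(* A nonzero projected vector lifts to a nonzero vector of [L] whose squared norm is larger by at
   most [q / 4]; by near minimality of [v] the lift has squared norm at least [q / 2]. *)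
have gap' x : piL x -> x != 0 -> q / 4 <= dot x x.
  move=> [y Ly <-] y0; have [m hm] := proj_reduce y v0.
  have yn0 : y - m%:~R *: v != 0.
    by apply: contra_neq y0 => h; rewrite -(projZ m) h mulmx0.
  have := vmin _ (LZ m y Ly) yn0; rewrite -/q in hm; lra.
have sL' : subgroup piL.
  split; first by exists 0; [case: sL|rewrite mulmx0].
  move=> _ _ [a La <-] [b Lb <-]; exists (a - b); last by rewrite mulmxBr.
  exact: sL.2.
have span' x : span_of L x -> span_of piL (proj v *m x).
  move=> spx a ha; rewrite -dot_proj; apply: spx => y Ly.
  by rewrite dot_proj; apply: ha; exists y.
have fd0 : 0 < 5 ^+ d :> R by rewrite exprn_gt0.
have fd1 : 1 <= 5 ^+ d.+1 :> R by rewrite exprn_ege1// ler1n.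
(* Rank one: [L] consists of the integer multiples of [v]. Either they cover the line at scale
   [rho], or [q^-1 *: v] is the required dual vector. *)
have [piL0|] := pselect (forall x, L x -> proj v *m x = 0).
  have [qrho|qrho] := leP (q / 4) rho.
    right=> x /span' spx; have px : proj v *m x = 0.
      apply: dot_eq0; apply: spx => _ [y Ly <-].
      by rewrite (piL0 _ Ly) dot0r.
    have [m] := proj_reduce x v0; rewrite px dot0r add0r => hm.
    by exists (m%:~R *: v); [exact: subgroupZ|exact: le_trans hm _].
  left; exists (q^-1 *: v); split.
  - move=> x Lx; have [m hm] := proj_reduce x v0.
    have /eqP : x - m%:~R *: v = 0.
      apply/eqP; apply: contraT => xn0.
      have := vmin _ (LZ m x Lx) xn0.
      rewrite piL0// dot0r -/q in hm; lra.
    rewrite subr_eq0 => /eqP ->; rewrite dotZl dotZr -/q mulrCA mulVf ?gt_eqF//.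
    by rewrite mulr1 intr_int.
  - by exists v => //; rewrite dotZl mulVf ?gt_eqF// oner_neq0.
  - rewrite dotZl dotZr -/q mulVf ?gt_eqF// mulr1.
    rewrite mulrC ler_pdivrMr//; nra.
move=> /existsNP[x1 /not_implyP[Lx1 /eqP px1]].
have piLn0 : exists2 x, piL x & x != 0.
  by exists (proj v *m x1) => //; exists x1.
have q40 : 0 < q / 4 by lra.
(* The budget [rho] splits into [rho / 5] for covering the projection and [4 * rho / 5] for [q / 4].
   This costs a factor 5 per dimension in the bound on the dual vector. *)
have rho50 : 0 < rho / 5 by lra.
pose f := linfun (mulmx (proj v) : 'cV[R]_n -> 'cV[R]_n).
have LU' x : piL x -> x \in (f @: U)%VS.
  move=> [y Ly <-]; have -> : proj v *m y = f y by rewrite lfunE.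
  by apply: memv_img; exact: LU.
(* The dimension drops because [v] lies in [U] and in the kernel of [f]. *)
have dU' : (\dim (f @: U) <= d)%N.
  rewrite -ltnS; apply: leq_trans dU; rewrite -(limg_ker_dim f U).
  rewrite -add1n leq_add2r lt0n dimv_eq0.
  apply: contraNneq (v0) => h; rewrite -memv0 -h memv_cap LU//=.
  by rewrite memv_ker lfunE/= proj_self.
have [[u [ui [w pLw uw] un]]|cov] := IH _ _ _ _ q40 rho50 sL' gap' LU' dU'.
  left; exists (proj v *m u); split.
  - by move=> x Lx; rewrite dot_proj; apply: ui; exists x.
  - by case: pLw uw => y Ly <-; rewrite -dot_proj => ?; exists y.
  - have := dot_proj_le u v0; have := dot_ge0 u; rewrite exprS => h1 h2; nra.
right; have [y [Ly y0 ymin]] := near_shortest q40 gap' piLn0.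
have [|z Lz hz] := cov (2^-1 *: y).
  by move=> a ha; rewrite dotZr ha// mulr0.
(* Half of the almost shortest [y] is covered by some [z]. If [y = 2 *: z], then [z] has a quarter
   of the squared norm of [y], against near minimality; otherwise [y - 2 *: z] is nonzero of squared
   norm at most [4 * rho / 5], and the gap [q / 4] applies to it. *)
have q16 : q <= 16 * (rho / 5).
  have e2 : y - 2 *: z = 2 *: (2^-1 *: y - z).
    by rewrite scalerBr scalerA divff ?scale1r// pnatr_eq0.
  have Lz2 : piL (y - 2 *: z) by apply: sL'.2 => //; exact: (subgroupZ 2 sL' Lz).
  have [/eqP|yz] := eqVneq (y - 2 *: z) 0.
    rewrite subr_eq0 => /eqP yE; have z0 : z != 0.
      by apply: contra_neq y0 => z0; rewrite yE z0 scaler0.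
    have := ymin _ Lz z0; rewrite {1 2}yE dotZl dotZr.
    have := dot_gt0 z0; lra.
  have := gap' _ Lz2 yz; rewrite e2 dotZl dotZr; lra.
move=> x spx; have [_ [w Lw <-] hw] := cov _ (span' _ spx).
have [m hm] := proj_reduce (x - w) v0.
exists (w + m%:~R *: v).
  rewrite -[X in w + X]opprK; apply: sL.2 => //; rewrite -sub0r.
  by apply: sL.2; [case: sL|exact: subgroupZ].
rewrite opprD addrA; apply: le_trans hm _.
rewrite mulmxBr -/q; lra.
Qed.

End Transference.

(** * Counting lattice points *)

(** Only the diagonal cofactor of row [p] survives, and its sign is [(-1) ^+ (p + p) = 1]. This
    serves both the elimination matrix and the shears. *)
Lemma det_row_scalar {R : comPzRingType} k (A : 'M[R]_k.+1) p (a b : R) :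
  A p p = a -> (forall j, j != p -> A p j = 0) ->
  row' p (col' p A) = b%:M -> \det A = a * b ^+ k.
Proof.
move=> Apa Ap0 Ab; rewrite (expand_det_row A p) (bigD1 p)//= big1 => [|j jp].
  by rewrite addr0 Apa /cofactor Ab det_scalar addnn -mul2n exprM sqrrN !expr1n mul1r.
by rewrite Ap0// mul0r.
Qed.

Lemma int_between {R : realType} (a len : R) (m : int) :
  a <= m%:~R <= a + len ->
  exists2 i, (i < (Num.truncn len).+1)%N & m = Num.ceil a + i%:Z.
Proof.
move=> /andP[am ma]; have cm : Num.ceil a <= m by rewrite ceil_le_int.
exists `|m - Num.ceil a|%N; last by rewrite gez0_abs ?subr_ge0// addrCA subrr addr0.
rewrite ltnS -[leqLHS](@natrK R) le_truncn// natr_absz.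
rewrite ger0_norm ?subr_ge0// intrB; have := ceil_ge a; lra.
Qed.

Definition consv {T : Type} k (x : T) (v : 'cV[T]_k) : 'cV[T]_k.+1 :=
  \col_i (if unlift 0 i is Some j then v j 0 else x).

Lemma consvE {T : Type} k (v : 'cV[T]_k.+1) :
  v = consv (v 0 0) (\col_j v (lift 0 j) 0).
Proof.
apply/matrixP => i j; rewrite (ord1 j) !mxE.
by case: unliftP => [l|] -> //; rewrite mxE.
Qed.

(** At each elimination step, 3 comes from the choices of the first coordinate and [2 ^ k'] from
    doubling a box in [k'] dimensions. *)
Fixpoint count_const (k : nat) : nat :=
  if k is k'.+1 then 3 * 2 ^ k' * count_const k' else 1.

Lemma count_const_gt0 k : (0 < count_const k)%N.
Proof. by elim: k => //= k IH; rewrite !muln_gt0 IH expn_gt0. Qed.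

(* Gaussian elimination with partial pivoting: as the pivot is maximal in its
   column, eliminating that column at most doubles the box. *)
Lemma lattice_points_in_box {R : realType} k (f : 'M[R]_k) : \det f != 0 ->
  exists T0 : R, forall T, T0 <= T -> exists ms : seq 'cV[int]_k,
    (forall m : 'cV[int]_k, (forall i, `|(f *m map_mx intr m) i 0| <= T) -> m \in ms)
    /\ (size ms)%:R <= (count_const k)%:R * T ^+ k / `|\det f|.
Proof.
elim: k f => [|k IH] f df.
  exists 0 => T _; exists [:: 0]; split => [m _|/=].
    by rewrite inE; apply/eqP/matrixP => -[].
  by rewrite det_mx00 normr1 divr1 expr0 mulr1.
pose p := [arg max_(i > 0 | true) `|f i 0|]%O.
have pmax i : `|f i 0| <= `|f p 0|.
  by rewrite /p; case: arg_maxP => // j _ /(_ i); exact.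
set d := f p 0.
have d0 : d != 0.
  apply: contra_neq df => dz; rewrite (expand_det_col f 0) big1// => i _.
  have := pmax i; rewrite -/d dz normr0 normr_le0 => /eqP ->.
  by rewrite mul0r.
have nd0 : 0 < `|d| by rewrite normr_gt0.
pose w i := if i == p then 0 else f i 0 / d.
have w1 i : `|w i| <= 1.
  rewrite /w; case: eqP; first by rewrite normr0.
  by rewrite normrM normfV ler_pdivrMr// mul1r pmax.
(* [E] subtracts [w i] times the pivot row from row [i]; as [w p = 0], the pivot row itself is
   kept. *)
pose E : 'M[R]_k.+1 := \matrix_(i, j) ((i == j)%:R - w i * (j == p)%:R).
have detE : \det E = 1.
  rewrite (@det_row_scalar _ _ E p 1 1) ?expr1n ?mulr1//.
  - by rewrite mxE eqxx /w eqxx mul0r subr0.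
  - by move=> j jp; rewrite mxE eq_sym (negbTE jp) /w eqxx mul0r subr0.
  - apply/matrixP => i j; rewrite !mxE (inj_eq lift_inj).
    by rewrite [lift p j == p]eq_sym (negbTE (neq_lift _ _)) mulr0 subr0.
have EE q (x : 'M[R]_(k.+1, q)) i j : (E *m x) i j = x i j - w i * x p j.
  rewrite mxE; under eq_bigr do rewrite mxE mulrBl; rewrite sumrB; congr (_ - _).
    rewrite (bigD1 i)//= eqxx mul1r big1 ?addr0// => l li.
    by rewrite eq_sym (negbTE li) mul0r.
  rewrite (bigD1 p)//= eqxx mulr1 big1 ?addr0// => l li.
  by rewrite (negbTE li) mulr0 mul0r.
pose A := E *m f; pose G := row' p (col' 0 A).
have A0 i : A (lift p i) 0 = 0.
  rewrite EE /w eq_sym (negbTE (neq_lift _ _)) -mulrA mulVf//.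
  by rewrite mulr1 subrr.
have detG : `|\det f| = `|d| * `|\det G|.
  have -> : \det f = \det A by rewrite det_mulmx detE mul1r.
  rewrite (expand_det_col A 0) (bigD1 p)//= big1 => [|i ip].
    rewrite addr0 normrM /cofactor normrM normrX normrN1 expr1n mul1r.
    by rewrite EE /w eqxx mul0r subr0.
  by case: (unliftP p i) ip => [j ->|-> /eqP//]; rewrite A0 mul0r.
have dG : \det G != 0.
  by apply: contra_neq df => h; apply/eqP; rewrite -normr_eq0 detG h normr0 mulr0.
have ndG : 0 < `|\det G| by rewrite normr_gt0.
have [T0 HT0] := IH G dG.
(* The bound [T0 / 2] allows the induction hypothesis at [2 * T]; the bound [|d|] absorbs the extra
   1 in the count of first coordinates. *)
exists (Num.max `|d| (T0 / 2)) => T; rewrite ge_max => /andP[dT T0T].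
have [|ms' [mem' size']] := HT0 (2 * T); first lra.
have T_ge0 : 0 < T by apply: lt_le_trans dT.
pose len := 2 * T / `|d|.
have len0 : 0 <= len by rewrite divr_ge0//; lra.
pose c (m' : 'cV[int]_k) := \sum_j f p (lift 0 j) * (m' j 0)%:~R.
(* Once the tail [m'] is fixed, the pivot row confines the first coordinate to an interval of length
   [len] centred at [- (c m' / d)]. *)
pose lo m' := Num.ceil (- (c m' / d) - T / `|d|).
exists [seq consv (lo m' + i%:Z) m' | m' <- ms', i <- iota 0 (Num.truncn len).+1].
split=> [m fm|].
  pose m' := (\col_j m (lift 0 j) 0).
  have m'ms : m' \in ms'.
    apply: mem' => i.
    have -> : (G *m map_mx intr m') i 0 = (A *m map_mx intr m) (lift p i) 0.
      rewrite !mxE [RHS]big_ord_recl A0 mul0r add0r.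
      by apply: eq_bigr => j _; rewrite !mxE.
    rewrite -mulmxA EE (le_trans (ler_normB _ _))// normrM.
    have := fm (lift p i); have := fm p; have := w1 (lift p i).
    set x := `|w _|; set y := `|_ p 0|; set z := `|_|; move=> h1 h2 h3.
    have : x * y <= 1 * T by rewrite ler_pM// normr_ge0.
    lra.
  have [|i iN mi] := @int_between R (- (c m' / d) - T / `|d|) len (m 0 0).
    have := fm p; rewrite mxE big_ord_recl mxE -/d.
    have -> : \sum_(i < k) f p (lift ord0 i) * map_mx intr m (lift ord0 i) 0 = c m'.
      by apply: eq_bigr => j _; rewrite !mxE.
    have -> : d * (m ord0 0)%:~R + c m' = d * ((m 0 0)%:~R + c m' / d).
      by rewrite mulrDr mulrCA divff// mulr1.
    rewrite normrM mulrC -ler_pdivlMr// ler_norml => /andP[h1 h2].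
    have lenE : len = T / `|d| + T / `|d| by rewrite /len -mulrA; ring.
    by rewrite lenE; apply/andP; split; lra.
  rewrite [m]consvE -/m'; apply/allpairsP; exists (m', i).
  split => //; last by rewrite mi.
  by rewrite mem_iota.
rewrite size_allpairs size_iota natrM detG.
have N3 : (Num.truncn len).+1%:R <= 3 * T / `|d|.
  rewrite -natr1; have := truncn_le len; rewrite len0 => h.
  have : 1 <= T / `|d| by rewrite ler_pdivlMr// mul1r.
  rewrite /len -!mulrA in h *; lra.
apply: le_trans (ler_pM _ _ size' N3) _ => //.
rewrite !natrM natrX exprMn exprS le_eqVlt; apply/orP; left; apply/eqP.
by field; rewrite !gt_eqF.
Qed.

(** * Grids and their duals *)

Section RealContinuity.
Context {R : realType} {T : topologicalType}.

Lemma continuous_sumr {I : Type} (r : seq I) (P : pred I) (F : I -> T -> R) :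
  (forall i, P i -> continuous (F i)) ->
  continuous (fun x => \sum_(i <- r | P i) F i x).
Proof. by apply: continuous_big; exact: add_continuous. Qed.

Lemma continuous_prodr {I : Type} (r : seq I) (P : pred I) (F : I -> T -> R) :
  (forall i, P i -> continuous (F i)) ->
  continuous (fun x => \prod_(i <- r | P i) F i x).
Proof. by apply: continuous_big; exact: mul_continuous. Qed.

Lemma continuous_mulr (f g : T -> R) :
  continuous f -> continuous g -> continuous (fun x => f x * g x).
Proof. by move=> cf cg x; apply: cvgM; [exact: cf|exact: cg]. Qed.

Lemma continuous_determinant n (A : T -> 'M[R]_n) :
  (forall i j, continuous (fun x => A x i j)) -> continuous (fun x => \det (A x)).
Proof.
move=> cA; apply: continuous_sumr => s _; apply: continuous_mulr.
  by move=> x; exact: cvg_cst.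
by apply: continuous_prodr => i _; exact: cA.
Qed.

Lemma continuous_adjugate n (A : T -> 'M[R]_n) i j :
  (forall i j, continuous (fun x => A x i j)) ->
  continuous (fun x => (\adj (A x)) i j).
Proof.
move=> cA.
have -> : (fun x => (\adj (A x)) i j) =
    (fun x => (-1) ^+ (j + i) * \det (row' j (col' i (A x)))).
  by apply/funext => x; rewrite mxE.
apply: continuous_mulr; first by move=> x; exact: cvg_cst.
apply: continuous_determinant => p q.
have -> : (fun x => row' j (col' i (A x)) p q) =
    (fun x => A x (lift j p) (lift i q)).
  by apply/funext => x; rewrite !mxE.
exact: cA.
Qed.

Lemma open_norm_lt (f : T -> R) (r : R) : continuous f -> open [set x | `|f x| < r].
Proof.
move=> cf; apply: (@open_comp _ _ f [set y | `|y| < r]); first by move=> x _; exact: cf.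
apply: (@open_comp _ _ (@Num.norm R R) [set y | y < r]); last exact: open_lt.
by move=> x _; exact: norm_continuous.
Qed.

Lemma open_norm_gt (f : T -> R) (r : R) : continuous f -> open [set x | r < `|f x|].
Proof.
move=> cf; apply: (@open_comp _ _ f [set y | r < `|y|]); first by move=> x _; exact: cf.
apply: (@open_comp _ _ (@Num.norm R R) [set y | r < y]); last exact: open_gt.
by move=> x _; exact: norm_continuous.
Qed.

Lemma open_forall {I : finType} (P : I -> set T) :
  (forall i, open (P i)) -> open [set x | forall i, P i x].
Proof.
move=> oP; have -> : [set x | forall i, P i x] = \big[setI/setT]_(i : I) P i.
  rewrite -bigcap_seq; apply/seteqP; split => [x Px i _|x Px i]; first exact: Px.
  by apply: Px; rewrite /= mem_index_enum.
elim/big_ind: _ => //; [exact: openT|exact: openI].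
Qed.

End RealContinuity.

Section Grid.
Context {R : realType} {n : nat}.
Implicit Types (a : ASL R n) (L : grid R n) (u : 'cV[R]_n).

Lemma mx_norm_lt (x : 'cV[R]_n) (r : R) :
  0 < r -> `|x| < r <-> forall i, `|x i 0| < r.
Proof.
move=> r0; rewrite [`|x|]/Num.norm/= mx_normrE; split=> [h i|h].
  apply: le_lt_trans h.
  exact: (@le_bigmax _ _ _ _ (fun ij => `|x ij.1 ij.2|) (i, 0)).
by apply: bigmax_lt => // -[i j] _ /=; rewrite (ord1 j).
Qed.

Lemma grid_of_surj L : exists a, L = grid_of a.
Proof.
have /set_mem[a _ aL] := valP L; exists a; apply/val_inj.
by rewrite /= aL.
Qed.

Lemma ASL_det a : \det (val a).1 = 1.
Proof. by have /set_mem := valP a. Qed.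

Lemma grid_of_points a x : grid_points (grid_of a) x <->
  exists m : 'cV[int]_n, x = (val a).1 *m map_mx intr m + (val a).2.
Proof.
split=> [[_ [m _ <-] <-]|[m ->]]; first by exists m.
by exists (map_mx intr m) => //; exists m.
Qed.

(** Taking differences of grid points makes this the dual of the underlying lattice, independent of
    the representative and of translations. *)
Definition dual L : set 'cV[R]_n :=
  [set u | forall x y, grid_points L x -> grid_points L y ->
    dot u (x - y) \is a Num.int].

Lemma dual_grid_of a u : dual (grid_of a) u <->
  exists m : 'cV[int]_n, (val a).1^T *m u = map_mx intr m.
Proof.
split=> [du|[m mE] _ _ /grid_of_points[p ->] /grid_of_points[q ->]].
  exists (\col_i Num.floor (((val a).1^T *m u) i 0)).
  apply/matrixP => i j; rewrite (ord1 j) [RHS]mxE [X in _ = X%:~R]mxE floorK//.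
  rewrite -dot_mulmx_delta.
  have -> : (val a).1 *m delta_mx i 0 =
      ((val a).1 *m map_mx intr (delta_mx i 0 : 'cV[int]_n) + (val a).2) -
      ((val a).1 *m map_mx intr (0 : 'cV[int]_n) + (val a).2).
    by rewrite map_mx0 mulmx0 add0r addrK map_delta_mx.
  by apply: du; apply/grid_of_points; [exists (delta_mx i 0)|exists 0].
have -> x : (val a).1 *m map_mx intr p + x - ((val a).1 *m map_mx intr q + x) =
  (val a).1 *m map_mx intr (p - q).
  by rewrite opprD addrACA subrr addr0 -mulmxBr map_mxB.
rewrite -[(val a).1]trmxK -dot_mulmx mE dotE; apply: rpred_sum => i _.
by rewrite !mxE rpredM// intr_int.
Qed.

(** With determinant 1 the adjugate is the inverse, and its entries are polynomials in those of the
    matrix, which gives continuity. *)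
Lemma dual_grid_ofE a u : dual (grid_of a) u <->
  exists m : 'cV[int]_n, u = (\adj (val a).1)^T *m map_mx intr m.
Proof.
split=> [/dual_grid_of[m mE]|[m ->]].
  exists m; rewrite -mE mulmxA -trmx_mul mul_mx_adj ASL_det trmx1 mul1mx//.
apply/dual_grid_of; exists m.
by rewrite mulmxA -trmx_mul mul_adj_mx ASL_det trmx1 mul1mx.
Qed.

Lemma dualZ L u (m : int) : dual L u -> dual L (m%:~R *: u).
Proof.
by move=> du x y Lx Ly; rewrite dotZl rpredM ?intr_int//; exact: du.
Qed.

(** The strict inequalities make this set open. The lower bound on one coordinate is what later
    limits the number of shears that shorten a given vector. *)
Definition dual_in (i : 'I_n) (lo r : R) : set (borel_grid R n) :=
  [set L | exists u, [/\ dual L u, lo < `|u i 0| & forall j, `|u j 0| < r]].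

Lemma open_borel_grid (U : set (grid R n)) :
  open U -> measurable (U : set (borel_grid R n)).
Proof. by move=> oU; apply: sub_sigma_algebra. Qed.

Lemma ASL_mx_continuous i j : continuous (fun a : ASL R n => (val a).1 i j).
Proof.
move=> a; apply: (@continuous_comp _ _ _ (fun a : ASL R n => (val a).1)
  (fun M : 'M[R]_n => M i j)); last exact: coord_continuous.
apply: (@continuous_comp _ _ _ (val : ASL R n -> _) fst); last exact: cvg_fst.
exact: initial_continuous.
Qed.

Lemma ASL_cV_continuous i : continuous (fun a : ASL R n => (val a).2 i 0).
Proof.
move=> a; apply: (@continuous_comp _ _ _ (fun a : ASL R n => (val a).2)
  (fun M : 'cV[R]_n => M i 0)); last exact: coord_continuous.
apply: (@continuous_comp _ _ _ (val : ASL R n -> _) snd); last exact: cvg_snd.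
exact: initial_continuous.
Qed.

(** For each integer vector the conditions are strict inequalities on continuous functions of the
    representative; the set is the union of these open sets. *)
Lemma measurable_dual_in i lo r : measurable (dual_in i lo r).
Proof.
apply: open_borel_grid; rewrite /open/= /grid_open.
pose F (m : 'cV[int]_n) (j : 'I_n) (a : ASL R n) :=
  ((\adj (val a).1)^T *m map_mx intr m) j 0.
have cF m j : continuous (F m j).
  have -> : F m j = (fun a => \sum_l \adj (val a).1 l j * (m l 0)%:~R).
    by apply/funext => a; rewrite /F mxE; apply: eq_bigr => l _; rewrite !mxE.
  apply: continuous_sumr => l _.
  apply: (@continuous_mulr _ _ (fun a : ASL R n => \adj (val a).1 l j)
    (fun=> (m l 0)%:~R)); last exact: cst_continuous.
  by apply: continuous_adjugate; exact: ASL_mx_continuous.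
have -> : grid_of @^-1` (dual_in i lo r) = \bigcup_m
    ([set a | lo < `|F m i a|] `&` [set a | forall j, `|F m j a| < r]).
  apply/seteqP; split => [a [u [/dual_grid_ofE[m ->] h1 h2]]|a [m _ [h1 h2]]].
    by exists m.
  exists ((\adj (val a).1)^T *m map_mx intr m); split => //.
  by apply/dual_grid_ofE; exists m.
apply: bigcup_open => m _; apply: openI; first exact: open_norm_gt.
by apply: open_forall => j; exact: open_norm_lt.
Qed.

Definition misses (r : R) : set (borel_grid R n) :=
  [set L | forall x, grid_points L x -> r <= `|x|].

Lemma Delta_geE (z : R) : [set L | (z%:E <= Delta L)%E] = misses (expR z).
Proof.
apply/seteqP; split => L /=; rewrite /Delta.
  rewrite -(expeRK z%:E) lee_lne ?in_itv/= ?leey ?andbT ?expeR_ge0//; last first.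
    by apply: le_ereal_inf_tmp => _ [x _ <-]; rewrite lee_fin.
  move=> h x Lx; rewrite -lee_fin; apply: le_trans h _.
  by apply: ereal_inf_lbound; exists x.
move=> h; rewrite -(expeRK z%:E) lee_lne ?in_itv/= ?leey ?andbT ?expeR_ge0//.
  by apply: le_ereal_inf_tmp => _ [x Lx <-]; rewrite lee_fin; exact: h.
by apply: le_ereal_inf_tmp => _ [x _ <-]; rewrite lee_fin.
Qed.

(** The complement is open: a grid point in the open ball comes from an integer vector, whose image
    varies continuously with the representative. *)
Lemma measurable_misses r : 0 < r -> measurable (misses r).
Proof.
move=> r0; rewrite -[misses r]setCK; apply: measurableC.
apply: open_borel_grid; rewrite /open/= /grid_open.
pose F (m : 'cV[int]_n) (j : 'I_n) (a : ASL R n) :=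
  ((val a).1 *m map_mx intr m + (val a).2) j 0.
have cF m j : continuous (F m j).
  have -> : F m j =
      (fun a => (\sum_l (val a).1 j l * (m l 0)%:~R) + (val a).2 j 0).
    apply/funext => a; rewrite /F !mxE; congr (_ + _).
    by apply: eq_bigr => l _; rewrite !mxE.
  suff cS : continuous (fun a : ASL R n => \sum_l (val a).1 j l * (m l 0)%:~R).
    by move=> a; apply: (cvgD (cS a) (@ASL_cV_continuous j a)).
  apply: continuous_sumr => l _.
  apply: (@continuous_mulr _ _ (fun a : ASL R n => (val a).1 j l)
    (fun=> (m l 0)%:~R)); last exact: cst_continuous.
  exact: ASL_mx_continuous.
have -> : grid_of @^-1` (~` misses r) = \bigcup_m
    [set a | forall j, `|F m j a| < r].
  apply/seteqP; split => [a /existsNP[x /not_implyP[/grid_of_points[m ->] /negP]]|].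
    by rewrite -ltNge mx_norm_lt// => h; exists m.
  move=> a [m _ h] /(_ ((val a).1 *m map_mx intr m + (val a).2)).
  rewrite leNgt => h'.
  have /negP := h' (iffRL (grid_of_points _ _) (ex_intro _ m erefl)).
  by apply; apply/mx_norm_lt.
by apply: bigcup_open => m _; apply: open_forall => j; exact: open_norm_lt.
Qed.

(* [ASL_pair h y] is the affine map with linear part [h] only when [\det h = 1];
   otherwise it is the translation by [y]. *)
Lemma ASL_pair_subproof (h : 'M[R]_n) (y : 'cV[R]_n) :
  (if \det h == 1 then h else 1%:M, y) \in ASL_set.
Proof. by apply/mem_set; rewrite /ASL_set/=; case: eqP => // _; rewrite det1. Qed.

Definition ASL_pair h y : ASL R n := SigSub (ASL_pair_subproof h y).

Lemma ASL_pairE h y : \det h = 1 -> val (ASL_pair h y) = (h, y).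
Proof. by move=> dh; rewrite /= dh eqxx. Qed.

Lemma grid_act_points a L x : grid_points (grid_act a L) x <->
  exists2 y, grid_points L y & x = affine (val a) y.
Proof. by split=> [[y Ly <-]|[y Ly ->]]; [exists y|exists y]. Qed.

(** The action on duals is contragredient: the inverse transpose acting on grids moves dual vectors
    by [h] itself. *)
Lemma dual_act (h : 'M[R]_n) L u : \det h = 1 ->
  dual (grid_act (ASL_pair (invmx h)^T 0) L) (h *m u) <-> dual L u.
Proof.
move=> dh; have hu : h \in unitmx by rewrite unitmxE dh unitr1.
have e x y : dot (h *m u) (affine (val (ASL_pair (invmx h)^T 0)) x -
    affine (val (ASL_pair (invmx h)^T 0)) y) = dot u (x - y).
  rewrite ASL_pairE ?det_tr ?det_inv ?dh ?invr1// /affine/= !addr0 -mulmxBr.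
  by rewrite dot_mulmx mulmxA -trmx_mul mulVmx// trmx1 mul1mx.
split=> du x y.
  move=> Lx Ly; rewrite -e; apply: du; apply/grid_act_points.
    by exists x.
  by exists y.
by move=> /grid_act_points[x' Lx ->] /grid_act_points[y' Ly ->]; rewrite e; exact: du.
Qed.

End Grid.

Lemma continuous_mx {R : realType} {T : topologicalType} p q (A : T -> 'M[R]_(p, q)) :
  (forall i j, continuous (fun x => A x i j)) -> continuous A.
Proof.
move=> cA x; apply/cvg_ballP => e e0; near=> y; split=> //.
near: y; apply: filter_forall => i; apply: filter_forall => j.
by move/cvg_ballP: (cA i j x); apply.
Unshelve. all: by end_near. Qed.

(** * Measurability of the affine action on grids *)

Section Action.
Context {R : realType} {n : nat}.
Implicit Types (a b : ASL R n) (L : grid R n).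

Lemma ASL_mul_subproof a b :
  ((val a).1 *m (val b).1, affine (val a) (val b).2) \in ASL_set.
Proof. by apply/mem_set; rewrite /ASL_set/= det_mulmx !ASL_det mulr1. Qed.

Definition ASL_mul a b : ASL R n := SigSub (ASL_mul_subproof a b).

Lemma grid_act_of a b : grid_act a (grid_of b) = grid_of (ASL_mul a b).
Proof.
apply/val_inj; rewrite /= /grid_points/= image_comp; apply: eq_imagel => v _ /=.
by rewrite /affine/= mulmxDr mulmxA addrA.
Qed.

Lemma ASL_mul_continuous a : continuous (ASL_mul a).
Proof.
apply: (@continuous_comp_initial _ _ _ val).
suff [c1 c2] : continuous (fun b => (val a).1 *m (val b).1) /\
    continuous (fun b => affine (val a) (val b).2).
  by move=> b; apply: (cvg_pair (c1 b) (c2 b)).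
split; apply: continuous_mx => i j.
  have -> : (fun b => ((val a).1 *m (val b).1) i j) =
      (fun b => \sum_l (val a).1 i l * (val b).1 l j).
    by apply/funext => b; rewrite mxE.
  apply: continuous_sumr => l _.
  apply: (@continuous_mulr _ _ (fun=> (val a).1 i l)
    (fun b : ASL R n => (val b).1 l j)); first exact: cst_continuous.
  exact: ASL_mx_continuous.
have -> : (fun b => affine (val a) (val b).2 i j) =
    (fun b => (\sum_l (val a).1 i l * (val b).2 l 0) + (val a).2 i 0).
  by apply/funext => b; rewrite /affine !mxE (ord1 j).
suff cS : continuous (fun b : ASL R n => \sum_l (val a).1 i l * (val b).2 l 0).
  by move=> b; apply: (cvgD (cS b) (@cst_continuous _ _ ((val a).2 i 0) b)).
apply: continuous_sumr => l _.
apply: (@continuous_mulr _ _ (fun=> (val a).1 i l)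
  (fun b : ASL R n => (val b).2 l 0)); first exact: cst_continuous.
exact: ASL_cV_continuous.
Qed.

Lemma measurable_grid_act a :
  measurable_fun setT (grid_act a : borel_grid R n -> borel_grid R n).
Proof.
apply: (@measurability _ _ (borel_grid R n) (borel_grid R n) setT _
  (@open (grid R n))) => // _ [U oU <-].
rewrite setTI; apply: open_borel_grid; rewrite /open/= /grid_open.
have -> : grid_of @^-1` (grid_act a @^-1` U) = ASL_mul a @^-1` (grid_of @^-1` U).
  by apply/seteqP; split => b /=; rewrite grid_act_of.
by apply: open_comp => [b _|]; [exact: ASL_mul_continuous|exact: oU].
Qed.

Lemma measurable_act_preimage a (A : set (borel_grid R n)) :
  measurable A -> measurable (grid_act a @^-1` A : set (borel_grid R n)).
Proof. by move=> mA; rewrite -[X in measurable X]setTI; exact: measurable_grid_act. Qed.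

End Action.

Lemma measure_cover {R : realType} (d : measure_display) (T : measurableType d)
    (mu : {measure set T -> \bar R}) (I : finType) (A : set T)
    (F : I -> set T) (v : \bar R) :
  measurable A -> (forall i, measurable (F i)) ->
  (forall x, A x -> exists i, F i x) -> (forall i, (mu (F i) <= v)%E) ->
  (mu A <= #|I|%:R%:E * v)%E.
Proof.
move=> mA mF AF Fv.
(* Subadditivity is stated for sequences, so [F] is enumerated and continued by the empty set. *)
pose G (j : nat) := if (j < #|I|)%N =P true is ReflectT h
  then F (enum_val (Ordinal h)) else set0.
have GE (i : 'I_#|I|) : G i = F (enum_val i).
  rewrite /G; case: eqP => [h|]; last by rewrite ltn_ord.
  by congr (F (enum_val _)); exact: val_inj.
apply: (@le_trans _ _ (\sum_(j < #|I|) mu (G j))%E).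
  apply: content_subadditive => //.
    by move=> j /= jI; rewrite -[j]/(val (Ordinal jI)) GE.
  move=> x /AF[i Fi]; rewrite -bigcup_mkord; exists (enum_rank i) => //=.
  by rewrite GE enum_rankK.
apply: (@le_trans _ _ (\sum_(j < #|I|) v)%E).
  by apply: lee_sum => j _; rewrite GE.
by rewrite sumr_const card_ord mule_natl.
Qed.

(** * Shears and short dual vectors *)

Section Shear.
Context {R : realType} {k : nat}.
Implicit Types (i : 'I_k.+1) (s : 'I_k -> R) (u : 'cV[R]_k.+1).

(** Coordinate [i] is divided by [b ^+ k], and every other coordinate is multiplied by [b] after
    adding a multiple of coordinate [i]. The cube of size [r] thus pulls back to a thin tube of
    length [b ^+ k * r] and width [r / b]. *)
Definition shear_mx i (b : R) s : 'M[R]_k.+1 := \matrix_(j, l)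
  if unlift i j is Some j' then b * ((j == l)%:R + s j' * (l == i)%:R)
  else (b ^+ k)^-1 * (l == i)%:R.

Lemma det_shear_mx i b s : b != 0 -> \det (shear_mx i b s) = 1.
Proof.
move=> b0; rewrite (@det_row_scalar _ _ _ i (b ^+ k)^-1 b).
- by rewrite mulVf ?expf_neq0.
- by rewrite mxE unlift_none eqxx mulr1.
- by move=> j ji; rewrite mxE unlift_none (negbTE ji) mulr0.
- apply/matrixP => p q; rewrite !mxE liftK (inj_eq lift_inj).
  by rewrite [lift i q == i]eq_sym (negbTE (neq_lift _ _)) mulr0 addr0 mulr_natr.
Qed.

Lemma shear_mx_pivot i b s u : (shear_mx i b s *m u) i 0 = u i 0 / b ^+ k.
Proof.
rewrite mxE (bigD1 i)//= mxE unlift_none eqxx mulr1 mulrC big1 ?addr0// => j ji.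
by rewrite mxE unlift_none (negbTE ji) mulr0 mul0r.
Qed.

Lemma shear_mx_lift i b s u j :
  (shear_mx i b s *m u) (lift i j) 0 = b * (u (lift i j) 0 + s j * u i 0).
Proof.
rewrite mxE (bigD1 i)//= (bigD1 (lift i j))/=; last first.
  by rewrite eq_sym neq_lift.
rewrite !mxE liftK !eqxx [lift i j == i]eq_sym (negbTE (neq_lift _ _)).
rewrite big1 => [|l /andP[li lj]].
  by rewrite !mulr1n !mulr0n; ring.
by rewrite mxE liftK [_ == l]eq_sym (negbTE lj) (negbTE li) mulr0 addr0 mulr0 mul0r.
Qed.

(* The shears with integer parameter [b] use slopes in [-1, 1] with step
   [b ^- k.+1]. *)
Definition slope (b : nat) (s : {ffun 'I_k -> 'I_(2 * b ^ k.+1).+1}) (j : 'I_k) : R :=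
  (s j)%:R / b%:R ^+ k.+1 - 1.

Definition shear_act i (b : nat) (s : {ffun 'I_k -> 'I_(2 * b ^ k.+1).+1}) :
    ASL R k.+1 :=
  ASL_pair (invmx (shear_mx i b%:R (slope s)))^T 0.

End Shear.

Section Short.
Context {R : realType} {k : nat}.
Local Notation n := k.+1.
Implicit Types (L : grid R n) (u : 'cV[R]_n).

(** Having a nonzero dual vector of norm below [r], written as a finite union so that measurability
    is immediate. *)
Definition short (r : R) : set (borel_grid R n) :=
  \big[setU/set0]_(i < n) dual_in i 0 r.

Lemma measurable_short r : measurable (short r).
Proof. by apply: bigsetU_measurable => i _; exact: measurable_dual_in. Qed.

Lemma shortP r L :
  short r L <-> exists u, [/\ dual L u, u != 0 & forall j, `|u j 0| < r].
Proof.
rewrite /short -bigcup_seq; split.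
  move=> [i _ [u [du ui ur]]]; exists u; split => //.
  by apply: contraTneq ui => ->; rewrite mxE normr0 ltxx.
move=> [u [du u0 ur]].
have [i ui] : exists i, u i 0 != 0.
  apply/existsP; apply: contraNT u0; rewrite negb_exists => /forallP h.
  apply/eqP/matrixP => i j; rewrite (ord1 j) mxE; apply/eqP.
  by have := h i; rewrite negbK.
exists i; first by rewrite /= mem_index_enum.
by exists u; split => //; rewrite normr_gt0.
Qed.

Lemma max_coord u : exists i, forall j, `|u j 0| <= `|u i 0|.
Proof.
exists [arg max_(i > 0 | true) `|u i 0|]%O => j.
by case: arg_maxP => // i _ /(_ j); exact.
Qed.

Lemma max_coord_neq0 u i : u != 0 -> (forall j, `|u j 0| <= `|u i 0|) -> 0 < `|u i 0|.
Proof.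
move=> u0 imax; rewrite lt_def normr_ge0 andbT; apply: contra_neq u0 => ui.
apply/matrixP => j l; rewrite (ord1 l) mxE; apply/eqP.
by rewrite -normr_le0 -ui imax.
Qed.

(** Integer multiples of a dual vector are dual, so a short one can be doubled until its largest
    coordinate reaches [[r / 2, r)]. *)
Lemma short_doubling r L : short r L ->
  exists i u, [/\ dual L u, r / 2 <= `|u i 0| & forall j, `|u j 0| < r].
Proof.
move=> /shortP[u [du u0 ur]]; have [i imax] := max_coord u; exists i.
have ui := max_coord_neq0 u0 imax.
have r0 : 0 < r by apply: le_lt_trans (ur i).
have ex : exists m : nat, r / 2 <= 2 ^+ m * `|u i 0|.
  exists (Num.truncn (r / `|u i 0|)).
  rewrite -ler_pdivrMr//; set q := r / 2 / _; set t := Num.truncn _.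
  have qE : q = r / `|u i 0| / 2 by rewrite /q; field; rewrite gt_eqF.
  have : r / `|u i 0| < t.+1%:R by exact: truncnS_gt.
  have : t.+1%:R <= 2 ^+ t :> R by rewrite -natrX ler_nat ltn_expl.
  have : 0 < r / `|u i 0| by exact: divr_gt0.
  rewrite qE -natr1; lra.
case: (ex_minnP ex) => m hm mmin.
have n2 j : `|(((2 ^ m)%:Z)%:~R *: u) j 0| = 2 ^+ m * `|u j 0|.
  by rewrite mxE normrM -[X in `|X|]/((2 ^ m)%:R) natrX normrX normr_nat.
exists (((2 ^ m)%:Z)%:~R *: u); split; first exact: dualZ.
  by rewrite n2.
move=> j; rewrite n2; apply: (@le_lt_trans _ _ (2 ^+ m * `|u i 0|)).
  by rewrite ler_wpM2l ?exprn_ge0.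
(* By minimality of the exponent, the vector before the last doubling was below [r / 2]. *)
case: m mmin {hm n2} => [|m] mmin; first by rewrite expr0 mul1r.
rewrite ltNge; apply/negP => hr.
have /mmin : r / 2 <= 2 ^+ m * `|u i 0| by rewrite exprS in hr; lra.
by rewrite ltnn.
Qed.

(** Normalising by the largest coordinate of [u] puts its direction in a cube, and some shear slope
    approximates it within [b ^- n]. That shear sends [u] to a vector of norm at most
    [|u i 0| / b ^+ k]. *)
Lemma short_cover (b : nat) (C r : R) L : (0 < b)%N -> C <= b%:R ^+ k * r ->
  short C L ->
  exists i (s : {ffun 'I_k -> 'I_(2 * b ^ n).+1}),
    short r (grid_act (shear_act i s : ASL R n) L).
Proof.
move=> b0 Cr /shortP[u [du u0 uC]]; have [i imax] := max_coord u.
have ui := max_coord_neq0 u0 imax.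
have ui0 : u i 0 != 0 by rewrite -normr_gt0.
have bR : 0 < b%:R :> R by rewrite ltr0n.
have bk : 0 < b%:R ^+ k :> R by rewrite exprn_gt0.
pose N : R := b%:R ^+ n.
have N0 : 0 < N by rewrite exprn_gt0.
pose q j := u (lift i j) 0 / u i 0.
have q1 j : `|q j| <= 1 by rewrite /q normrM normfV ler_pdivrMr// mul1r.
(* Since [N * (1 - q j)] lies in [[0, 2 * N]], its integer part is in range and [inord] does not
   return its default. *)
pose s : {ffun 'I_k -> 'I_(2 * b ^ n).+1} :=
  [ffun j => inord (Num.truncn (N * (1 - q j)))].
have sE j : ((s j)%:R <= N * (1 - q j) < (s j)%:R + 1).
  have /andP[q1' q2'] : -1 <= q j <= 1 by rewrite -ler_norml.
  have h0 : 0 <= N * (1 - q j) by rewrite mulr_ge0 ?(ltW N0)// subr_ge0.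
  rewrite ffunE inordK ?natr1 ?truncn_itv// ltnS truncn_le_nat.
  rewrite -natr1 natrM natrX -/N; nra.
have ns j : `|u (lift i j) 0 + slope s j * u i 0| <= `|u i 0| / N.
  have -> : u (lift i j) 0 + slope s j * u i 0 = u i 0 * (q j + slope s j).
    by rewrite /q; field.
  rewrite normrM ler_wpM2l// /slope -/N.
  have -> : q j + ((s j)%:R / N - 1) = - ((N * (1 - q j) - (s j)%:R) / N).
    by field; rewrite gt_eqF.
  rewrite normrN normrM normfV (gtr0_norm N0) ler_piMl ?invr_ge0 ?ltW//.
  have /andP[h1 h2] := sE j; rewrite ger0_norm; lra.
exists i, s; apply/shortP.
exists (shear_mx i b%:R (slope s) *m u); split.
- by apply/dual_act => //; rewrite det_shear_mx// gt_eqF.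
- apply: contra_neq ui0 => h; have := shear_mx_pivot i b%:R (slope s) u.
  rewrite h mxE => /esym/eqP; rewrite mulf_eq0 invr_eq0 [_ ^+ k == 0]gt_eqF// orbF.
  by move/eqP.
- have small : `|u i 0| / b%:R ^+ k < r.
    by rewrite ltr_pdivrMr// mulrC; apply: lt_le_trans Cr.
  move=> j; case: (unliftP i j) => [j' ->|->].
    rewrite shear_mx_lift normrM (gtr0_norm bR); apply: le_lt_trans small.
    apply: (@le_trans _ _ (b%:R * (`|u i 0| / N))); first by rewrite ler_wpM2l// ltW.
    rewrite /N exprS le_eqVlt; apply/orP; left; apply/eqP.
    by field; rewrite !gt_eqF.
  by rewrite shear_mx_pivot normrM normfV (gtr0_norm bk).
Qed.

(** Modulo 1, the points far from the integers form an arc of length 1/2. A step shorter than 1/2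
    cannot jump over it, and two steps of at least 1/4 leave the bad arc. *)
Lemma walk_escape (th sg : R) : 4^-1 <= `|sg| < 2^-1 ->
  exists j : 'I_3, forall m : int, 4^-1 <= `|th + j%:R * sg + m%:~R|.
Proof.
have good (x : R) : 4^-1 <= x <= 3 / 4 -> forall m : int, 4^-1 <= `|x + m%:~R|.
  move=> /andP[x1 x2] [m|m].
    have h : 0 <= m%:R :> R by [].
    by rewrite -pmulrn ger0_norm; lra.
  have h : 0 <= m%:R :> R by [].
  by rewrite NegzE mulrNz -pmulrn -[m.+1%:R]natr1 ler0_norm; lra.
have [th0|] := pselect (forall m : int, 4^-1 <= `|th + m%:~R|).
  by move=> _; exists 0 => m; rewrite mul0r addr0.
move=> /existsNP[m0 /negP]; rewrite -ltNge ltr_norml => /andP[t1 t2].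
wlog sg0 : th sg m0 t1 t2 / 0 <= sg => [W|].
  have [sg0|sg0] := leP 0 sg; first exact: (W th sg m0).
  move=> hs; have [||||j hj] := W (- th) (- sg) (- m0).
  - by rewrite mulrNz; lra.
  - by rewrite mulrNz; lra.
  - lra.
  - by rewrite normrN.
  exists j => m; have := hj (- m).
  by rewrite mulrNz mulrN -!opprD normrN.
rewrite ger0_norm// => /andP[s1 s2].
have shift (x : R) : (forall m : int, 4^-1 <= `|th + m0%:~R + x + m%:~R|) ->
    forall m : int, 4^-1 <= `|th + x + m%:~R|.
  move=> h m; have := h (m - m0); rewrite intrB.
  by congr (_ <= `|_|); ring.
have [h|h] := leP 4^-1 (th + m0%:~R + sg).
  exists 1; rewrite mul1r; apply: shift; apply: good; lra.
exists (inord 2); rewrite inordK//; apply: shift; apply: good; lra.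
Qed.

(** On the grid [dot u] takes values in a single class modulo 1, and each translation shifts that
    class by [u i 0 / (2 * rho)], of absolute value in [[1/4, 1/2)]. After a suitable shift all
    values are at least 1/4 in absolute value, whereas on the ball they are below [n * rho * r]. *)
Lemma short_misses_cover (rho r : R) L : 0 < rho -> 0 < r ->
  n%:R * rho * r <= 4^-1 -> short rho L ->
  exists i (j : 'I_3), misses r (grid_act
    (ASL_pair 1%:M ((j%:R / (2 * rho)) *: delta_mx i 0) : ASL R n) L).
Proof.
move=> rho0 r0 nr /short_doubling[i [u [du u1 u2]]].
have [a La] := grid_of_surj L.
have [x0 Lx0] : exists x, grid_points L x.
  by rewrite La; eexists; apply/grid_of_points; exists 0.
have [|j hj] := @walk_escape (dot u x0) (u i 0 / (2 * rho)).
  have rr : 0 < 2 * rho by lra.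
  rewrite normrM normfV (gtr0_norm rr) ler_pdivlMr// ltr_pdivrMr//.
  have := u2 i; lra.
exists i, j => _ /grid_act_points[x Lx ->].
rewrite leNgt; apply/negP => /(mx_norm_lt _ r0) xr.
set y := affine _ _ in xr.
have yE : dot u y = dot u x0 + j%:R * (u i 0 / (2 * rho)) + dot u (x - x0).
  rewrite /y /affine ASL_pairE ?det1//= mul1mx dotBr dotDr dotZr.
  have -> : dot u (delta_mx i 0) = u i 0.
    rewrite dotE (bigD1 i)//= mxE !eqxx mulr1 big1 ?addr0// => l li.
    by rewrite mxE (negbTE li) mulr0.
  ring.
have : `|dot u y| < 4^-1.
  apply: lt_le_trans nr; rewrite dotE; apply: le_lt_trans (ler_norm_sum _ _ _) _.
  have -> : n%:R * rho * r = \sum_(l < n) (rho * r).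
    by rewrite sumr_const card_ord -mulrA mulr_natl.
  apply: ltr_sum => [|l _]; first by apply/hasP; exists i; rewrite ?mem_index_enum.
  by rewrite normrM ltr_pM.
have /intrP[m mE] := du x x0 Lx Lx0.
by rewrite yE mE ltNge hj.
Qed.

End Short.

(** * Averaging *)

Lemma card_cover_seq (S : finType) (M : eqType) (P : pred S) (Q : M -> pred S)
    (ms : seq M) (c : nat) :
  (forall s, P s -> exists2 m, m \in ms & Q m s) -> (forall m, (#|Q m| <= c)%N) ->
  (#|P| <= size ms * c)%N.
Proof.
move=> PQ Qc; rewrite cardE.
apply: (@leq_trans (size (flatten [seq enum (Q m) | m <- ms]))).
  apply: uniq_leq_size; first exact: enum_uniq.
  move=> s; rewrite mem_enum => /PQ[m mms Qms]; apply/flattenP.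
  by exists (enum (Q m)); [apply: map_f|rewrite mem_enum].
elim: ms {PQ} => //= m ms IH; rewrite size_cat mulSn leq_add//.
by rewrite -cardE.
Qed.

Lemma card_near_le {R : realType} (N : nat) (x : R) :
  (#|[pred t : 'I_N | (`|t%:R - x| < 4)%R]| <= 9)%N.
Proof.
set A := [pred t : 'I_N | _].
rewrite cardE -(size_map (fun t : 'I_N => Posz t)).
apply: (@leq_trans (size [seq Num.ceil (x - 4) + i%:Z | i <- iota 0 9])) => //.
apply: uniq_leq_size.
  by rewrite map_inj_uniq ?enum_uniq// => t t' /= [] /val_inj.
move=> z /mapP[t]; rewrite mem_enum inE ltr_norml => /andP[h1 h2] ->.
have [|i iN ->] := @int_between R (x - 4) 8 t.
  by rewrite -pmulrn; lra.
rewrite (natrK 8) in iN.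
by apply/mapP; exists i => //; rewrite mem_iota.
Qed.

(* The sets where the averages of order at least [m] exceed [c] decrease to the
   empty set, so their measures tend to 0. *)
Lemma averaging_bound {R : realType} (d : measure_display) (T : measurableType d)
    (mu : probability T R) (I : nat -> finType) (F : forall m, I m -> set T)
    (v c : R) :
  (forall m s, measurable (@F m s)) -> (forall m s, (v%:E <= mu (@F m s))%E) ->
  0 <= c -> (forall m, (0 < #|I m|)%N) ->
  (forall x, exists m0, forall m, (m0 <= m)%N ->
    #|[pred s | x \in @F m s]|%:R <= c * #|I m|%:R) ->
  v <= c.
Proof.
move=> mF vF c0 I0 ev.
pose f m x : R := \sum_(s : I m) \1_(@F m s) x.
have fE m x : f m x = #|[pred s | x \in @F m s]|%:R.
  rewrite /f -sum1_card natr_sum [RHS]big_mkcond; apply: eq_bigr => s _.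
  by rewrite indicE inE; case: (_ \in _).
have fI m x : f m x <= #|I m|%:R by rewrite fE ler_nat max_card.
have mf m : measurable_fun setT (f m).
  by apply: measurable_sum => s; exact: measurable_indic.
pose G m := [set x | c * #|I m|%:R < f m x].
have mG m : measurable (G m).
  have -> : G m = setT `&` f m @^-1` `]c * #|I m|%:R, +oo[.
    by rewrite setTI; apply/seteqP; split => x /=; rewrite in_itv/= andbT.
  by apply: mf => //; exact: measurable_itv.
pose B m := \bigcup_(l >= m) G l.
have mB m : measurable (B m) by apply: bigcup_measurable.
have B0 : \bigcap_m B m = set0.
  apply/seteqP; split => // x Bx; have [m0 hm0] := ev x.
  have [l lm] := Bx m0 Logic.I; rewrite /G/= fE; have := hm0 l lm.
  by rewrite leNgt => /negP.
have cB : mu \o B @ \oo --> (0 : \bar R)%E.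
  rewrite -(measure0 mu) -B0; apply: nonincreasing_cvg_mu => //.
  - by rewrite (le_lt_trans (probability_le1 _ _))// ltry.
  - by rewrite B0.
  - apply/nonincreasing_seqP => m; apply/subsetPset => x [l /= ml Gl].
    by exists l => //=; exact: ltnW.
(* It remains to compare two estimates of the integral of [f m]: from below by the measures of the
   [F m s], from above by [c * #|I m|] off [B m] and by [#|I m|] on [B m]. *)
suff bound m : (v%:E <= c%:E + mu (B m))%E.
  have cc : (fun m => c%:E + mu (B m))%E @ \oo --> (c%:E + 0)%E.
    by apply: cvgeD => //; [exact: cvg_cst].
  rewrite -lee_fin -[c%:E]adde0 -(cvg_lim _ cc)//.
  by apply: lime_ge; [apply/cvg_ex; eexists; exact: cc|apply: nearW].
have K0 : 0 < #|I m|%:R :> R by rewrite ltr0n.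
set K := #|I m|%:R in K0.
have le1 : ((K * v)%:E <= \int[mu]_x (f m x)%:E)%E.
  rewrite /f; under eq_integral do rewrite -sumEFin.
  rewrite ge0_integral_sum//; last first.
    by move=> s; apply/measurable_EFinP; exact: measurable_indic.
  have -> : ((K * v)%:E = \sum_(s : I m) v%:E)%E.
    by rewrite sumEFin sumr_const mulr_natl.
  by apply: lee_sum => s _; rewrite integral_indic// setIT; exact: vF.
have le2 : (\int[mu]_x (f m x)%:E <= (K * c)%:E + K%:E * mu (B m))%E.
  apply: (@le_trans _ _ (\int[mu]_x ((K * c)%:E + K%:E * (\1_(B m) x)%:E))%E).
    apply: ge0_le_integral => //.
    - by move=> x _; rewrite lee_fin fE.
    - exact/measurable_EFinP.
    - apply: emeasurable_funD => //; apply/measurable_EFinP/measurable_funM => //.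
    - move=> x _; rewrite -EFinM -EFinD lee_fin indicE.
      have [xB|xB] := boolP (x \in B m).
        by rewrite mulr1 (le_trans (fI _ _))// lerDr mulr_ge0// ltW.
      rewrite mulr0 addr0 leNgt; apply/negP => h; move/negP: xB; apply.
      by apply/mem_set; exists m => //=; rewrite /G/= mulrC.
  rewrite ge0_integralD//; last 3 first.
  - by move=> x _; rewrite lee_fin mulr_ge0// ltW.
  - by move=> x _; rewrite -EFinM lee_fin mulr_ge0// ltW.
  - by apply/measurable_EFinP/measurable_funM => //; exact: measurable_indic.
  rewrite integral_cst//= probability_setT mule1 ge0_integralZl//; last 2 first.
  - by apply/measurable_EFinP; exact: measurable_indic.
  - by rewrite lee_fin ltW.
  by rewrite integral_indic// setIT.
have := le_trans le1 le2.
rewrite EFinM [in X in (_ <= X)%E]EFinM -ge0_muleDr ?lee_fin ?measure_ge0//.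
by rewrite lee_pmul2l// lte_fin.
Qed.

(** * From a missed ball to a short dual vector *)

Section Upper.
Context {R : realType} {k : nat}.
Local Notation n := k.+1.
Implicit Types (a : ASL R n) (L : grid R n) (u : 'cV[R]_n).

Definition lattice_of a : set 'cV[R]_n :=
  range (fun m : 'cV[int]_n => (val a).1 *m map_mx intr m).

(** A lattice vector that is too short is carried by the inverse matrix to an integer vector with
    entries below 1 in absolute value, hence to 0. The gap depends on [a], but the bounds in
    [transference] do not depend on it. *)
Lemma lattice_gap a : exists2 e : R, 0 < e &
  forall x, lattice_of a x -> x != 0 -> e <= dot x x.
Proof.
pose A := \adj (val a).1.
pose S := 1 + \sum_i \sum_j `|A i j|.
have S0 : 0 < S by rewrite ltr_pwDl// sumr_ge0// => i _; rewrite sumr_ge0.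
exists (S^-1 ^+ 2); first by rewrite exprn_gt0// invr_gt0.
move=> _ [m _ <-]; set x := _ *m _ => x0; rewrite leNgt; apply/negP => xS.
have xj j : `|x j 0| < S^-1.
  rewrite -(@ltr_pXn2r _ 2)// ?nnegrE ?invr_ge0 ?(ltW S0)//.
  by rewrite real_normK ?num_real//; apply: le_lt_trans (sqr_coord_le_dot _ _) xS.
have mE : A *m x = map_mx intr m.
  by rewrite /x mulmxA mul_adj_mx ASL_det mul1mx.
suff m0 : m = 0 by rewrite /x m0 map_mx0 mulmx0 eqxx in x0.
apply/matrixP => i j; rewrite (ord1 j) [RHS]mxE.
have : `|(A *m x) i 0| < 1.
  rewrite mxE; apply: le_lt_trans (ler_norm_sum _ _ _) _.
  apply: (@le_lt_trans _ _ ((\sum_l `|A i l|) * S^-1)).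
    by rewrite mulr_suml; apply: ler_sum => l _; rewrite normrM ler_wpM2l// ltW.
  rewrite ltr_pdivrMr// mul1r /S [X in _ < _ + X](bigD1 i)//=.
  have : 0 <= \sum_(p < n | p != i) \sum_q `|A p q|.
    by rewrite sumr_ge0// => p _; rewrite sumr_ge0.
  lra.
rewrite mE mxE -intr_norm ltrz1 => h.
by apply/eqP; rewrite -absz_eq0; move: h; rewrite -abszE; case: (absz _).
Qed.

Lemma misses_short : exists2 C : R, 0 < C & forall (r : R) L, 0 < r ->
  misses r L -> short (C / r) L.
Proof.
pose d := \dim (fullv : {vspace 'cV[R]_n}).
have d1 : 1 <= 5 ^+ d :> R by rewrite exprn_ege1// ler1n.
(* With [rho = r ^+ 2 / 4] the dual vector satisfies [dot u u * r ^+ 2 <= 4 * 5 ^+ d], which is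
   strictly below the square of this constant. *)
exists (3 * 5 ^+ d); first by rewrite mulr_gt0// exprn_gt0.
move=> r L r0; have [a ->] := grid_of_surj L => La.
have [e e0 gap] := lattice_gap a.
have rho0 : 0 < r ^+ 2 / 4 by rewrite divr_gt0// exprn_gt0.
have sL : subgroup (lattice_of a).
  split; first by exists 0 => //; rewrite map_mx0 mulmx0.
  move=> _ _ [p _ <-] [q _ <-]; exists (p - q) => //.
  by rewrite map_mxB mulmxBr.
have := @transference _ _ d _ fullv _ _ e0 rho0 sL gap (fun x _ => memvf x) (leqnn _).
case=> [[u [ui [x Lx ux] un]]|cov]; last first.
  (* Covering minus the translation part would give a grid point of norm at most [r / 2]. The
     lattice has full rank, so its span contains every vector. *)
  have [|_ [m _ <-]] := cov (- (val a).2).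
    move=> b hb; suff -> : b = 0 by rewrite dotC dot0r.
    have gb : (val a).1^T *m b = 0.
      apply/matrixP => i j; rewrite (ord1 j) -dot_mulmx_delta [RHS]mxE; apply: hb.
      by exists (delta_mx i 0); rewrite ?map_delta_mx.
    rewrite -[b]mul1mx -trmx1 -(ASL_det a) -mul_mx_adj trmx_mul -mulmxA gb.
    by rewrite mulmx0.
  set p := (_ - _) => hp.
  have : grid_points (grid_of a) (- p).
    by apply/grid_of_points; exists m; rewrite /p opprB opprK.
  move=> /La; rewrite leNgt normrN => /negP[]; apply/mx_norm_lt => // i.
  rewrite -(@ltr_pXn2r _ 2)// ?nnegrE ?(ltW r0)// real_normK ?num_real//.
  by apply: le_lt_trans (sqr_coord_le_dot _ _) _; lra.
apply/shortP; exists u; split.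
- apply/dual_grid_of; exists (\col_i Num.floor (((val a).1^T *m u) i 0)).
  apply/matrixP => i j; rewrite (ord1 j) [RHS]mxE [X in _ = X%:~R]mxE floorK//.
  rewrite -dot_mulmx_delta; apply: ui.
  by exists (delta_mx i 0); rewrite ?map_delta_mx.
- by apply: contra_neq ux => ->; rewrite dotC dot0r.
- move=> j; rewrite ltr_pdivlMr//.
  rewrite -(@ltr_pXn2r _ 2)// ?nnegrE ?mulr_ge0 ?(ltW r0) ?exprn_ge0//.
  rewrite exprMn real_normK ?num_real//.
  have := sqr_coord_le_dot u j; have := dot_ge0 u => h1 h2.
  have h3 : u j 0 ^+ 2 * r ^+ 2 <= dot u u * r ^+ 2.
    by rewrite ler_wpM2r// sqr_ge0.
  set D : R := 5 ^+ d in d1 un *.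
  nra.
Qed.

End Upper.

(** * Bounds on the measure *)

Section Bounds.
Context {R : realType} {k : nat}.
Local Notation n := k.+1.
Implicit Types (a : ASL R n) (L : grid R n) (u : 'cV[R]_n).

(* For fixed [u], each slope is confined to an interval of length less than
   [8 * b ^- n], whence at most 9 values of the corresponding integer. *)
Lemma card_shear_le (i : 'I_n) (b : nat) (r : R) u : (0 < b)%N -> 0 < r ->
  b%:R ^+ k * r / 4 < `|u i 0| ->
  (#|[pred s : {ffun 'I_k -> 'I_(2 * b ^ n).+1} |
      [forall j, (`|u (lift i j) 0 + slope s j * u i 0| < r / b%:R)%R]]| <= 9 ^ k)%N.
Proof.
move=> b0 r0 ui; set P := [pred s | _].
have bR : 0 < b%:R :> R by rewrite ltr0n.
have bk : 0 < b%:R ^+ k :> R by rewrite exprn_gt0.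
have ui0 : 0 < `|u i 0| by apply: lt_trans ui; rewrite divr_gt0 ?mulr_gt0.
have un0 : u i 0 != 0 by rewrite -normr_gt0.
pose N : R := b%:R ^+ n.
have N0 : 0 < N by rewrite exprn_gt0.
pose Q (j : 'I_k) := [pred t : 'I_(2 * b ^ n).+1 |
  `|t%:R - N * (1 - u (lift i j) 0 / u i 0)| < 4].
apply: (@leq_trans #|(family Q : simpl_pred {ffun 'I_k -> 'I_(2 * b ^ n).+1})|).
  apply: subset_leq_card; apply/fintype.subsetP => s; rewrite inE => /forallP Ps.
  apply/familyP => j; rewrite inE.
  have -> : (s j)%:R - N * (1 - u (lift i j) 0 / u i 0) =
      (u (lift i j) 0 + slope s j * u i 0) * N / u i 0.
    by rewrite /slope -/N; field; rewrite un0 gt_eqF.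
  rewrite !normrM normfV (gtr0_norm N0) ltr_pdivrMr//.
  apply: (@lt_trans _ _ (r / b%:R * N)); first by rewrite ltr_pM2r// Ps.
  have -> : r / b%:R * N = b%:R ^+ k * r by rewrite /N exprS; field; rewrite gt_eqF.
  lra.
have aux js : (foldr muln 1 [seq #|Q j| | j <- js] <= 9 ^ size js)%N.
  by elim: js => //= j js IH; rewrite [(9 ^ _)%N]expnS leq_mul//; exact: card_near_le.
by rewrite card_family (leq_trans (aux _))// -cardE card_ord.
Qed.

(** A dual vector landing in the target starts in the box of size [2 * b ^+ k * r], which for large
    [b] contains at most of order [(b ^+ k * r) ^+ n] dual vectors. Each of them serves at most
    [9 ^ k] shears, out of at least [(b ^+ k) ^+ n] in all. *)
Lemma grid_shear_count (i : 'I_n) (r : R) L : (0 < k)%N -> 0 < r ->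
  exists m0, forall m, (m0 <= m)%N ->
    #|[pred s : {ffun 'I_k -> 'I_(2 * m.+1 ^ n).+1} |
        L \in grid_act (shear_act i s) @^-1` (dual_in i (r / 4) r)]|%:R <=
    ((9 ^ k * count_const n * 2 ^ n)%:R * r ^+ n) *
      #|{: {ffun 'I_k -> 'I_(2 * m.+1 ^ n).+1}}|%:R.
Proof.
move=> k0 r0; have [a ->] := grid_of_surj L.
pose f := (\adj (val a).1)^T.
have df : \det f = 1.
  rewrite /f det_tr; have := congr1 determinant (mul_mx_adj (val a).1).
  by rewrite det_mulmx ASL_det mul1r det1.
have [|T0 hT0] := @lattice_points_in_box R n f; first by rewrite df oner_neq0.
(* For [b = m.+1] this gives [b > T0 / (2 * r)], so the box is large enough for the count, using
   [b <= b ^+ k]. *)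
exists (Num.truncn (T0 / (2 * r))) => m mm0.
set b := m.+1.
have bR : 0 < b%:R :> R by rewrite ltr0n.
have bk1 : b%:R <= b%:R ^+ k :> R.
  by rewrite -[leLHS]expr1 ler_weXn2l// ler1n.
have bk0 : 0 < b%:R ^+ k :> R by apply: lt_le_trans bk1.
have bkr0 : 0 < b%:R ^+ k * r by rewrite mulr_gt0.
have T0b : T0 <= 2 * (b%:R ^+ k * r).
  have h : T0 / (2 * r) < b%:R.
    by apply: lt_le_trans (truncnS_gt _) _; rewrite ler_nat ltnS.
  rewrite ltr_pdivrMr ?mulr_gt0// in h; nra.
have [ms [memms sizems]] := hT0 _ T0b.
pose Q (m : 'cV[int]_n) := [pred s : {ffun 'I_k -> 'I_(2 * b ^ n).+1} |
  (b%:R ^+ k * r / 4 < `|(f *m map_mx intr m) i 0|) &&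
  [forall j, `|(f *m map_mx intr m) (lift i j) 0 +
     slope s j * (f *m map_mx intr m) i 0| < r / b%:R]].
have card_le : (#|[pred s : {ffun 'I_k -> 'I_(2 * b ^ n).+1} | grid_of a \in
    grid_act (shear_act i s) @^-1` (dual_in i (r / 4) r)]| <= size ms * 9 ^ k)%N.
  apply: (@card_cover_seq _ _ _ Q).
    move=> s /= /set_mem [u' [du' lo hi]].
    pose h : 'M[R]_n := shear_mx i b%:R (slope s).
    have dh : \det h = 1 by rewrite det_shear_mx// gt_eqF.
    have hu : h \in unitmx by rewrite unitmxE dh unitr1.
    have uE : u' = h *m (invmx h *m u') by rewrite mulKVmx.
    rewrite uE in du' lo hi.
    move: du' => /(iffLR (dual_act _ _ dh))/dual_grid_ofE[m' mE].
    rewrite mE in lo hi; rewrite -/f in lo hi.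
    set u := f *m _ in lo hi.
    have lift_lt j : `|u (lift i j) 0 + slope s j * u i 0| < r / b%:R.
      have := hi (lift i j); rewrite shear_mx_lift normrM (gtr0_norm bR).
      by rewrite ltr_pdivlMr// mulrC.
    have ui : `|u i 0| < b%:R ^+ k * r.
      have := hi i; rewrite shear_mx_pivot normrM normfV (gtr0_norm bk0).
      by rewrite ltr_pdivrMr// mulrC.
    have rb : r / b%:R <= b%:R ^+ k * r.
      have b1 : 1 <= b%:R :> R by rewrite ler1n.
      rewrite [r / _]mulrC ler_wpM2r ?(ltW r0)//.
      by rewrite (le_trans _ (le_trans b1 bk1))// invf_le1.
    exists m'; last first.
      apply/andP; split; last by apply/forallP.
      move: lo; rewrite shear_mx_pivot normrM normfV (gtr0_norm bk0).
      rewrite ltr_pdivlMr// => lo.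
      by have : b%:R ^+ k * r / 4 < `|u i 0| by lra.
    apply: memms => j; rewrite -/u; case: (unliftP i j) => [j' ->|->]; last lra.
    have sl : `|slope s j' * u i 0| <= `|u i 0|.
      rewrite normrM ler_piMl// /slope.
      have N0 : 0 < b%:R ^+ n :> R by rewrite exprn_gt0.
      have : (s j')%:R / b%:R ^+ n <= 2 :> R.
        rewrite ler_pdivrMr// -natrX -natrM ler_nat -ltnS; exact: ltn_ord.
      have : 0 <= (s j')%:R / b%:R ^+ n :> R by rewrite divr_ge0// ltW.
      by move=> h1 h2; rewrite ler_norml; lra.
    have := lift_lt j'.
    have := ler_normB (u (lift i j') 0 + slope s j' * u i 0)
      (slope s j' * u i 0).
    rewrite addrK; lra.
  move=> m'.
  have [h|h] := boolP (b%:R ^+ k * r / 4 < `|(f *m map_mx intr m') i 0|).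
    apply: leq_trans (card_shear_le _ r0 h) => //.
    by apply: subset_leq_card; apply/fintype.subsetP => s; rewrite !inE => /andP[].
  rewrite eq_card0// => s; rewrite !inE (negbTE h)//.
apply: (@le_trans _ _ (size ms * 9 ^ k)%:R); first by rewrite ler_nat.
rewrite card_ffun !card_ord df normr1 divr1 in sizems *.
have bigger : (b%:R ^+ k) ^+ n <= ((2 * b ^ n).+1 ^ k)%:R :> R.
  rewrite natrX -exprM mulnC exprM lerXn2r// ?nnegrE ?exprn_ge0//.
  by rewrite -natrX ler_nat leqW// leq_pmull.
rewrite natrM mulrC.
have k9 : 0 <= (9 ^ k)%:R :> R by [].
apply: le_trans (ler_wpM2l k9 sizems) _.
have -> : (9 ^ k)%:R * ((count_const n)%:R * (2 * (b%:R ^+ k * r)) ^+ n) =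
   ((9 ^ k * count_const n * 2 ^ n)%:R * r ^+ n) * (b%:R ^+ k) ^+ n :> R.
  by rewrite !natrM [(2 ^ n)%:R]natrX !exprMn; ring.
by rewrite ler_wpM2l// mulr_ge0// exprn_ge0// ltW.
Qed.

(** By invariance all sheared preimages have the same measure, so averaging over the shears bounds
    it. *)
Lemma dual_in_le (mu : probability (borel_grid R n) R) (i : 'I_n) (r : R) :
  ASL_invariant mu -> (0 < k)%N -> 0 < r ->
  (mu (dual_in i (r / 4) r) <= ((9 ^ k * count_const n * 2 ^ n)%:R * r ^+ n)%:E)%E.
Proof.
move=> hmu k0 r0; set v := mu _.
have vfin : v \is a fin_num by apply: fin_num_measure; exact: measurable_dual_in.
rewrite -(fineK vfin) lee_fin.
apply: (@averaging_bound _ _ _ mu (fun m => {: {ffun 'I_k -> 'I_(2 * m.+1 ^ n).+1}})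
  (fun m s => grid_act (shear_act i s) @^-1` (dual_in i (r / 4) r))).
- by move=> m s; apply: measurable_act_preimage; exact: measurable_dual_in.
- by move=> m s; rewrite (fineK vfin) hmu//; exact: measurable_dual_in.
- by rewrite mulr_ge0// exprn_ge0// ltW.
- by move=> m; rewrite card_ffun !card_ord expn_gt0.
- by move=> L; exact: grid_shear_count.
Qed.

End Bounds.

(** * Upper and lower bounds for the probability of missing a ball *)

Section Main.
Context {R : realType} {k : nat}.
Local Notation n := k.+1.
Context (mu : probability (borel_grid R n) R) (hmu : ASL_invariant mu).
Context (k0 : (0 < k)%N).

Lemma misses_upper : exists2 C : R, 0 < C & forall r : R, 0 < r ->
  (mu (misses r) <= (C / r ^+ n)%:E)%E.
Proof.
have [C1 C10 short_of_misses] := @misses_short R k.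
pose K : R := (9 ^ k * count_const n * 2 ^ n)%:R.
have K0 : 0 < K by rewrite ltr0n !muln_gt0 count_const_gt0 !expn_gt0.
exists (n%:R * (K * C1 ^+ n)); first by rewrite !mulr_gt0// exprn_gt0.
move=> r r0; have Cr0 : 0 < C1 / r by rewrite divr_gt0.
have := @measure_cover R _ _ mu 'I_n (misses r)
  (fun i => dual_in i (C1 / r / 4) (C1 / r)) (K * (C1 / r) ^+ n)%:E.
rewrite card_ord -EFinM.
have -> : n%:R * (K * C1 ^+ n) / r ^+ n = n%:R * (K * (C1 / r) ^+ n).
  by rewrite exprMn exprVn !mulrA.
apply.
- exact: measurable_misses.
- by move=> i; exact: measurable_dual_in.
(* Doubling yields a coordinate of at least half the radius, hence strictly above the quarter asked
   for by [dual_in]. *)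
- move=> L /(short_of_misses _ _ r0)/short_doubling[i [u [du u1 u2]]].
  by exists i, u; split => //; lra.
- by move=> i; exact: dual_in_le.
Qed.

(** Every grid has a nonzero dual vector, so the sets [short m.+1%:R] increase to the whole space
    and their measures tend to 1. *)
Lemma short_large : exists2 C : R, 1 <= C & ((2^-1)%:E <= mu (short C))%E.
Proof.
pose F (m : nat) := short (m.+1%:R : R) : set (borel_grid R n).
have FT : \bigcup_m F m = setT.
  apply/seteqP; split => // L _; have [a ->] := grid_of_surj L.
  pose u : 'cV[R]_n := (\adj (val a).1)^T *m delta_mx 0 0.
  have du : dual (grid_of a) u.
    by apply/dual_grid_ofE; exists (delta_mx 0 0); rewrite map_delta_mx.
  have u0 : u != 0.
    apply/negP => /eqP h; have := congr1 (mulmx (val a).1^T) h.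
    rewrite mulmxA -trmx_mul mul_adj_mx ASL_det trmx1 mul1mx mulmx0.
    by move=> /matrixP/(_ 0 0)/eqP; rewrite !mxE !eqxx oner_eq0.
  have [i imax] := max_coord u.
  exists (Num.truncn `|u i 0|) => //; apply/shortP; exists u; split => // j.
  exact: le_lt_trans (imax j) (truncnS_gt _).
have mF m : measurable (F m) by exact: measurable_short.
have cF : mu \o F @ \oo --> (1 : \bar R)%E.
  rewrite -(probability_setT mu) -FT; apply: nondecreasing_cvg_mu => //.
    by rewrite FT.
  apply/nondecreasing_seqP => m; apply/subsetPset => L /shortP[u [du u0 ur]].
  apply/shortP; exists u; split => // j; apply: lt_le_trans (ur j) _.
  by rewrite ler_nat.
have [[m hm]|h] := pselect (exists m, ((2^-1)%:E <= mu (F m))%E).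
  by exists m.+1%:R => //; rewrite ler1n.
exfalso; have : ((1 : \bar R) <= (2^-1)%:E)%E.
  rewrite -(cvg_lim _ cF)//; apply: lime_le.
    by apply/cvg_ex; eexists; exact: cF.
  apply: nearW => m /=; rewrite leNgt; apply/negP => /ltW h'.
  by apply: h; exists m.
by rewrite lee_fin; lra.
Qed.

(** When [b ^+ k] is of order [C / r], the number of shears is of order [(C / r) ^+ n], the expected
    ratio. *)
Lemma short_le_short (b : nat) (C r : R) : (0 < b)%N -> C <= b%:R ^+ k * r ->
  (mu (short C) <= (n * (2 * b ^ n).+1 ^ k)%:R%:E * mu (short r))%E.
Proof.
move=> b0 Cr.
have := @measure_cover R _ _ mu
  ('I_n * {ffun 'I_k -> 'I_(2 * b ^ n).+1})%type (short C)
  (fun p => grid_act (shear_act p.1 p.2) @^-1` (short r)) (mu (short r)).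
rewrite card_prod card_ffun !card_ord; apply.
- exact: measurable_short.
- by move=> p; apply: measurable_act_preimage; exact: measurable_short.
- by move=> L /(short_cover b0 Cr)[i [s h]]; exists (i, s).
- by move=> p /=; rewrite hmu//; exact: measurable_short.
Qed.

Lemma short_le_misses (rho r : R) : 0 < rho -> 0 < r ->
  n%:R * rho * r <= 4^-1 ->
  (mu (short rho) <= (n * 3)%:R%:E * mu (misses r))%E.
Proof.
move=> rho0 r0 nr.
have := @measure_cover R _ _ mu ('I_n * 'I_3)%type (short rho)
  (fun p => grid_act (ASL_pair 1%:M
    ((p.2%:R / (2 * rho)) *: delta_mx p.1 0)) @^-1` (misses r)) (mu (misses r)).
rewrite card_prod !card_ord; apply.
- exact: measurable_short.
- by move=> p; apply: measurable_act_preimage; exact: measurable_misses.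
- by move=> L /(short_misses_cover rho0 r0 nr)[i [j h]]; exists (i, j).
- by move=> p /=; rewrite hmu//; exact: measurable_misses.
Qed.

(** The least admissible [b] overshoots by at most [2 ^+ k], since for [b >= 2] the predecessor
    fails and is at least [b / 2]. *)
Lemma exists_power_between (x : R) : 1 <= x ->
  exists2 b : nat, (0 < b)%N & x <= b%:R ^+ k <= 2 ^+ k * x.
Proof.
move=> x1; have ex : exists b : nat, x <= b%:R ^+ k.
  exists (Num.truncn x).+1; apply: le_trans (ltW (truncnS_gt x)) _.
  by rewrite -[leLHS]expr1 ler_weXn2l// ler1n.
case: (ex_minnP ex) => b xb bmin.
case: b => [|[|b]] in xb bmin *.
- by move: xb; rewrite mulr0n expr0n eqn0Ngt k0 mulr0n; lra.
- exists 1%N => //; rewrite xb expr1n/=.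
  by rewrite (le_trans x1)// ler_peMl ?exprn_ege1 ?ler1n//; lra.
exists b.+2 => //; rewrite xb/=.
have bx : b.+1%:R ^+ k < x.
  by rewrite ltNge; apply/negP => /bmin; rewrite ltnn.
apply: (@le_trans _ _ (2 ^+ k * b.+1%:R ^+ k)); last first.
  by rewrite ler_wpM2l ?exprn_ge0// ltW.
rewrite -exprMn lerXn2r ?nnegrE// -natrM ler_nat.
by rewrite mul2n -addnn addSnnS addnS ltnS leq_addl.
Qed.

Lemma misses_lower : exists2 c : R, 0 < c & forall r : R, 1 <= r ->
  ((c / r ^+ n)%:E <= mu (misses r))%E.
Proof.
have [C0 C1 hC] := short_large.
(* Up to [r ^+ n], the factors before the last bound the number of shears when [b ^+ k] is of order
   [4 * n * C0 * r]; the last one counts the translations. *)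
pose D : R := n%:R * 3 ^+ k * (2 ^+ k * (4 * n%:R * C0)) ^+ n * (n * 3)%:R.
have C00 : 0 < C0 by lra.
have D0 : 0 < D by rewrite !mulr_gt0// exprn_gt0// !mulr_gt0// exprn_gt0.
exists (2^-1 / D); first by rewrite divr_gt0.
move=> r r1; have r0 : 0 < r by lra.
(* The largest radius allowed by [short_le_misses]: [n * rho * r] is exactly 1/4. *)
pose rho := (4 * n%:R * r)^-1.
have nr0 : 0 < 4 * n%:R * r by rewrite !mulr_gt0.
have rho0 : 0 < rho by rewrite invr_gt0.
have nr : n%:R * rho * r <= 4^-1.
  rewrite le_eqVlt; apply/orP; left; apply/eqP; rewrite /rho.
  by field; rewrite gt_eqF//= gt_eqF// ltr0n.
have [|b b0 /andP[b1 b2]] := @exists_power_between (C0 / rho).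
  rewrite /rho invrK; have : 1 <= n%:R :> R by rewrite ler1n.
  by move=> n1; rewrite -[1]mulr1 ler_pM//; nra.
have mfin : mu (misses r) \is a fin_num.
  by apply: fin_num_measure; exact: measurable_misses.
have Cb : C0 <= b%:R ^+ k * rho by rewrite -ler_pdivrMr.
have := le_trans hC (short_le_short b0 Cb).
have p0 : (0 <= (n * (2 * b ^ n).+1 ^ k)%:R%:E :> \bar R)%E by rewrite lee_fin.
move=> /le_trans/(_ (lee_wpmul2l p0 (short_le_misses rho0 r0 nr))).
rewrite -(fineK mfin) -!EFinM !lee_fin; set v := fine _.
have v0 : 0 <= v by rewrite fine_ge0.
move=> hv; rewrite -mulrA -invfM ler_pdivrMr; last by rewrite (mulr_gt0 D0)// exprn_gt0.
apply: le_trans hv _; rewrite [v * _]mulrC mulrA ler_wpM2r//.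
have bb : (b%:R ^+ n) ^+ k <= (2 ^+ k * (4 * n%:R * C0)) ^+ n * r ^+ n :> R.
  rewrite -exprM mulnC exprM -exprMn lerXn2r ?nnegrE ?exprn_ge0//.
    by rewrite !mulr_ge0 ?exprn_ge0 ?(ltW C00) ?(ltW r0).
  apply: le_trans b2 _; rewrite /rho invrK le_eqVlt; apply/orP; left; apply/eqP; ring.
have NN : (((2 * b ^ n).+1 ^ k)%:R <= 3 ^+ k * (b%:R ^+ n) ^+ k :> R).
  rewrite natrX -exprMn lerXn2r ?nnegrE ?mulr_ge0 ?exprn_ge0//.
  rewrite -natrX -natrM ler_nat -[3%N]/(2 + 1)%N mulnDl mul1n -addn1 leq_add2l.
  by rewrite expn_gt0 b0.
rewrite natrM.
apply: (@le_trans _ _ (n%:R *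
  (3 ^+ k * ((2 ^+ k * (4 * n%:R * C0)) ^+ n * r ^+ n)) * (n * 3)%:R)).
  rewrite ler_wpM2r// ler_wpM2l//; apply: le_trans NN _.
  by rewrite ler_wpM2l// exprn_ge0.
by rewrite /D le_eqVlt; apply/orP; left; apply/eqP; ring.
Qed.

End Main.

Theorem theorem4p6 (R : realType) (k : nat) (hk : (2 <= k)%N)
    (mu : probability (borel_grid R k) R) (hmu : ASL_invariant mu) :
  exists c C : R, [/\ 0 < c, 0 < C &
    forall z : R, 0 <= z ->
      ((c * expR (- (k%:R * z)))%:E <= mu [set L | z%:E <= Delta L])%E /\
      (mu [set L | z%:E <= Delta L] <= (C * expR (- (k%:R * z)))%:E)%E].
Proof.
case: k hk mu hmu => [//|k] hk mu hmu.
have [c c0 lower] := misses_lower hmu hk.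
have [C C0 upper] := misses_upper hmu hk.
exists c, C; split => // z z0; rewrite Delta_geE.
have -> : expR (- (k.+1%:R * z)) = (expR z ^+ k.+1)^-1.
  by rewrite expRN mulrC expRM_natr.
(* The bounds are taken at [r = expR z]; [0 <= z] gives the condition [1 <= r] of the lower one. *)
by split; [apply: lower; rewrite -expR0 ler_expR|apply: upper; exact: expR_gt0].
Qed.
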